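(* Let $(\delta,K_1,K_2,C_0,C_1,\mathcal S)$ be a primitive admissible sequence of parameters such that $\mathcal S$ is a non-empty set of Henson constraints. Then $\mathcal K=\mathcal A^\delta_{K_1,K_2,C_0,C_1}\cap\mathcal A_{\mathcal S}$ has coherent EPPA.
   Context: $\mathcal A^\delta_{K_1,K_2,C_0,C_1}$ is the class of finite metric spaces with integer distances in $\{1,\dots,\delta\}$ such that for every triangle with perimeter $p$ and shortest side $m$: if $p$ odd then $2K_1<p<2K_2+2m$ and $p<C_1$; if $p$ even then $p<C_0$. With $C=\min(C_0,C_1)$, $C'=\max(C_0,C_1)$, numerical parameters are primitive admissible if: $3\le\delta<\infty$; $1\le K_1\le K_2\le 2\delta$; $2\delta<C_0,C_1\le3\delta+2$, $C_0$ even, $C_1$ odd; $C_0,C_1\ge 2\delta+2$; and either (II) $C\le 2\delta+K_1$, $C=2K_1+2K_2+1$, $K_1+K_2\ge\delta$, $K_1+2K_2\le 2\delta-1$, and ($C'=C+1$, or $C'>C+1$, $K_1=K_2$, $3K_2=2\delta-1$); or (III) $C>2\delta+K_1$, $K_1+2K_2\ge2\delta-1$, $3K_2\ge2\delta$, if $K_1+2K_2=2\delta-1$ then $C\ge2\delta+K_1+2$, and if $C'>C+1$ then $C\ge 2\delta+K_2$. A Henson constraint is a metric space all of whose distances are $1$ or $\delta$. $\mathcal A_{\mathcal S}$ is the class of finite metric spaces into which no member of $\mathcal S$ embeds. The sequence $(\delta,K_1,K_2,C_0,C_1,\mathcal S)$ is primitive admissible if the numerical parameters are, $\mathcal S$ is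 a set of such spaces each with at least 4 points and containing no triangle forbidden in $\mathcal A^\delta_{K_1,K_2,C_0,C_1}$, and in Case (III): if $K_1=\delta$ or $C=2\delta+2$ then $\mathcal S=\emptyset$. A class $\mathcal K$ has coherent EPPA if for every $\mathbf A\in\mathcal K$ there is $\mathbf B\in\mathcal K$ containing $\mathbf A$ as a substructure such that every partial automorphism $f$ (isomorphism between substructures) of $\mathbf A$ extends to an automorphism $\hat f$ of $\mathbf B$, and the map $f\mapsto\hat f$ is coherent: whenever $\mathrm{Dom}(f)=\mathrm{Dom}(h)$, $\mathrm{Range}(f)=\mathrm{Dom}(g)$, $\mathrm{Range}(g)=\mathrm{Range}(h)$ and $h=g\circ f$, also $\hat h=\hat g\circ\hat f$. *)

(* Defs.v *)
From HB Require Import structures.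
From mathcomp Require Import all_boot.

Set Implicit Arguments.
Unset Strict Implicit.
Unset Printing Implicit Defensive.

Definition is_metric (T : Type) (d : T -> T -> nat) : Prop :=
  [/\ forall x y, d x y = 0 <-> x = y,
      forall x y, d x y = d y x
    & forall x y z, d x z <= d x y + d y z].

(* Integer-valued metric spaces; the carrier may be infinite or empty. *)
Record metricSpace := MetricSpace {
  ms_sort :> Type;
  dist : ms_sort -> ms_sort -> nat;
  dist_metric : is_metric dist
}.

Record finMetricSpace := FinMetricSpace {
  fms_sort :> finType;
  fdist : fms_sort -> fms_sort -> nat;
  fdist_metric : is_metric fdist
}.

Coercion metric_of_fin (A : finMetricSpace) : metricSpace :=
  MetricSpace (fdist_metric A).

(* Distance-preserving maps are automatically injective. *)
Definition embedding (X Y : metricSpace) (e : X -> Y) : Prop :=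
  forall x y : X, dist (e x) (e y) = dist x y.

Definition embeds (X Y : metricSpace) : Prop :=
  exists e : X -> Y, embedding e.

Definition automorphism (X : metricSpace) (phi : X -> X) : Prop :=
  bijective phi /\ embedding phi.

Definition triangle_allowed (K1 K2 C0 C1 a b c : nat) : Prop :=
  let p := a + b + c in
  let m := minn a (minn b c) in
  (odd p -> [/\ 2 * K1 < p, p < 2 * K2 + 2 * m & p < C1]) /\
  (~~ odd p -> p < C0).

(* A triangle consists of three pairwise distinct points. *)
Definition no_forbidden_triangle (K1 K2 C0 C1 : nat) (X : metricSpace) : Prop :=
  forall x y z : X, x <> y -> y <> z -> x <> z ->
    triangle_allowed K1 K2 C0 C1 (dist x y) (dist y z) (dist x z).

Definition class_A (delta K1 K2 C0 C1 : nat) (A : finMetricSpace) : Prop :=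
  (forall x y : A, x <> y -> 1 <= fdist x y <= delta) /\
  no_forbidden_triangle K1 K2 C0 C1 A.

Definition class_AS (S : metricSpace -> Prop) (A : finMetricSpace) : Prop :=
  forall X : metricSpace, S X -> ~ embeds X A.

Definition henson_constraint (delta : nat) (X : metricSpace) : Prop :=
  forall x y : X, x <> y -> dist x y = 1 \/ dist x y = delta.

Section Admissible.

Variables delta K1 K2 C0 C1 : nat.

Let C := minn C0 C1.
Let C' := maxn C0 C1.

Definition case_II : Prop :=
  [/\ C <= 2 * delta + K1,
      C = 2 * K1 + 2 * K2 + 1,
      K1 + K2 >= delta,
      K1 + 2 * K2 <= 2 * delta - 1
    & C' = C + 1 \/ [/\ C' > C + 1, K1 = K2 & 3 * K2 = 2 * delta - 1]].

Definition case_III : Prop :=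
  [/\ C > 2 * delta + K1,
      K1 + 2 * K2 >= 2 * delta - 1,
      3 * K2 >= 2 * delta,
      K1 + 2 * K2 = 2 * delta - 1 -> C >= 2 * delta + K1 + 2
    & C' > C + 1 -> C >= 2 * delta + K2].

Definition primitive_admissible_num : Prop :=
  3 <= delta /\
  [/\ 1 <= K1, K1 <= K2 & K2 <= 2 * delta] /\
  [/\ 2 * delta < C0 <= 3 * delta + 2, 2 * delta < C1 <= 3 * delta + 2,
      ~~ odd C0 & odd C1] /\
  (2 * delta + 2 <= C0 /\ 2 * delta + 2 <= C1) /\
  (case_II \/ case_III).

Definition primitive_admissible (S : metricSpace -> Prop) : Prop :=
  [/\ primitive_admissible_num,
      forall X : metricSpace, S X ->
        [/\ henson_constraint delta X,
            exists i : 'I_4 -> X, injective i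
          & no_forbidden_triangle K1 K2 C0 C1 X]
    & case_III -> K1 = delta \/ C = 2 * delta + 2 ->
        forall X : metricSpace, ~ S X].

End Admissible.

(* A partial map is a finite function into option; the substructures of a
   metric space are its arbitrary (possibly empty) subsets. *)
Section PartialMap.

Variable T : finType.
Implicit Types f g : {ffun T -> option T}.

Definition pdom f : {set T} := [set x | f x != None].
Definition prange f : {set T} := [set y | [exists x, f x == Some y]].
Definition pcomp g f : {ffun T -> option T} := [ffun x => obind g (f x)].

End PartialMap.

(* Preservation of distances makes f an isomorphism between the substructures
   pdom f and prange f. *)
Definition partial_automorphism (A : finMetricSpace)
    (f : {ffun A -> option A}) : Prop :=
  forall x y x' y' : A, f x = Some x' -> f y = Some y' ->
    fdist x' y' = fdist x y.

(* The copy of A inside B is given by an embedding e : A -> B. *)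
Definition coherent_EPPA (K : finMetricSpace -> Prop) : Prop :=
  forall A : finMetricSpace, K A ->
  exists B : finMetricSpace, K B /\
  exists e : A -> B, embedding (X := A) (Y := B) e /\
  exists ext : {ffun A -> option A} -> B -> B,
    (forall f, partial_automorphism f ->
       automorphism (X := B) (ext f) /\
       (forall x y : A, f x = Some y -> ext f (e x) = e y)) /\
    (forall f g h,
       partial_automorphism f -> partial_automorphism g ->
       partial_automorphism h ->
       pdom f = pdom h -> prange f = pdom g -> prange g = prange h ->
       h = pcomp g f ->
       ext h =1 ext g \o ext f).

(* Main.v *)
From mathcomp Require Import all_boot fingroup perm path ssralg zmodp.
From mathcomp Require Import zify boolp.
Require Import Defs.

(* The finite space [A] is first embedded in a finite edge-labelled graph [B]
   to which all partial automorphisms extend coherently, in which every clique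
   is a copy of a subspace of [A], and in which every closed walk is good, where
   goodness is a condition on cyclic words of labels that survives gluing along
   a chord and holds for all long words. Such a graph is built by valuations: a
   vertex carries an extra value for every bad configuration, edges are kept
   only between compatible values, and the values are chosen so that the bad
   configuration does not lift. A shortest bad closed walk is an induced cycle,
   so it meets [A] in at most one edge; hence twisting the values along one edge
   of the cycle removes it without affecting the copy of [A].

   The missing distances of [B] are then filled in canonically: walks give upper
   and lower bounds for a distance, and a middle value is clamped to these
   bounds. The triangle conditions on the result are read off from the goodness
   of closed walks. Since no new distance equals 1 or [delta], every Henson
   constraint in the completed space is a clique of [B], hence lies in [A]. A
   non-empty [S] leaves Case (III) with [K1 < delta] and [C > 2 delta + 2], or
   Case (II) with [K1 = K2 = K], [3 K = 2 delta - 1], [C1 = 4 K + 1],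
   [C0 = 3 delta + 2], where the middle value has to be [K] or [K - 1] according
   to parity. *)

Set Implicit Arguments.
Unset Strict Implicit.
Unset Printing Implicit Defensive.

Import GRing.Theory.

(** * Coherent extension of partial injections *)

Lemma eq_option (T : Type) (o1 o2 : option T) :
  (forall x, o1 = Some x <-> o2 = Some x) -> o1 = o2.
Proof.
case: o1 o2 => [x|] [y|] // eqo; first by have [/(_ erefl) ->] := eqo x.
  by have [/(_ erefl)] := eqo x.
by have [_ /(_ erefl)] := eqo y.
Qed.

Definition pinjective (S T : Type) (p : S -> option T) : Prop :=
  forall x y z, p x = Some z -> p y = Some z -> x = y.

Section PartialMaps.

Variable T : finType.
Implicit Types (f g p : {ffun T -> option T}) (x y z : T).

Lemma pdomP p x : reflect (exists y, p x = Some y) (x \in pdom p).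
Proof.
by rewrite inE; case: (p x) => [y|]; constructor; [exists y | case].
Qed.

Lemma prangeP p y : reflect (exists x, p x = Some y) (y \in prange p).
Proof.
by rewrite inE; apply: (iffP existsP) => -[x /eqP]; exists x => //; apply/eqP.
Qed.

Lemma mem_pdom p x y : p x = Some y -> x \in pdom p.
Proof. by move=> pxy; apply/pdomP; exists y. Qed.

Lemma mem_prange p x y : p x = Some y -> y \in prange p.
Proof. by move=> pxy; apply/prangeP; exists x. Qed.

Lemma card_pdom p : pinjective p -> #|pdom p| = #|prange p|.
Proof.
move=> p_inj; have -> : prange p = [set odflt x (p x) | x in pdom p].
  apply/setP=> y; apply/prangeP/imsetP => [[x pxy]|[x /pdomP[z pxz] ->]].
    by exists x; rewrite ?pxy ?(mem_pdom pxy).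
  by exists x; rewrite pxz.
rewrite card_in_imset // => x y /pdomP[x' px] /pdomP[y' py].
by rewrite px py /= => eq_xy'; apply: p_inj px _; rewrite eq_xy'.
Qed.

Lemma pcompP f g x z :
  pcomp g f x = Some z <-> exists2 y, f x = Some y & g y = Some z.
Proof.
rewrite ffunE; split=> [|[y -> //]].
by case: (f x) => //= y gyz; exists y.
Qed.

Lemma pdom_comp f g : prange f = pdom g -> pdom (pcomp g f) = pdom f.
Proof.
move=> fg; apply/setP=> x; apply/pdomP/pdomP => -[y].
  by case/pcompP=> y' fxy' _; exists y'.
move=> fxy; have /pdomP[z gyz] : y \in pdom g by rewrite -fg (mem_prange fxy).
by exists z; apply/pcompP; exists y.
Qed.

Lemma prange_comp f g : prange f = pdom g -> prange (pcomp g f) = prange g.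
Proof.
move=> fg; apply/setP=> z; apply/prangeP/prangeP => -[x].
  by case/pcompP=> y _ gyz; exists y.
move=> gxz; have /prangeP[w fwx] : x \in prange f by rewrite fg (mem_pdom gxz).
by exists w; apply/pcompP; exists x.
Qed.

End PartialMaps.

Section PartialInjection.

Variables (T : finType) (W : {set T}).
Implicit Types (f g p : {ffun T -> option T}) (x y : T).

Definition pinjective_in p : Prop :=
  [/\ pinjective p, pdom p \subset W & prange p \subset W].

(* The complements of domain and range in [W] are matched in enumeration
   order; outside [W] the index overflows, so [nth] returns its default [x]. *)
Definition pext_fun p x : T :=
  if p x is Some y then y
  else nth x (enum (W :\: prange p)) (index x (enum (W :\: pdom p))).

Definition pext p : {perm T} :=
  if pselect (injective (pext_fun p)) is left inj then perm inj else 1%g.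

Lemma size_compl_pdom p : pinjective_in p ->
  size (enum (W :\: pdom p)) = size (enum (W :\: prange p)).
Proof.
case=> p_inj /setIidPr domW /setIidPr ranW.
by rewrite -!cardE !cardsD domW ranW card_pdom.
Qed.

Lemma pext_fun_None p x : pinjective_in p -> x \in W -> p x = None ->
  pext_fun p x \in W :\: prange p /\
  index (pext_fun p x) (enum (W :\: prange p)) = index x (enum (W :\: pdom p)).
Proof.
move=> pP xW px; rewrite /pext_fun px.
have idx : index x (enum (W :\: pdom p)) < size (enum (W :\: prange p)).
  by rewrite -size_compl_pdom // index_mem mem_enum !inE px xW.
by rewrite index_uniq ?enum_uniq // -mem_enum mem_nth.
Qed.

Lemma pext_fun_out p x : pinjective_in p -> x \notin W -> pext_fun p x = x.
Proof.
move=> pP xW; have [_ /subsetP domW _] := pP; rewrite /pext_fun.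
case px: (p x) => [y|]; first by rewrite domW // (mem_pdom px) in xW.
rewrite nth_default // -size_compl_pdom // leqNgt index_mem mem_enum inE.
by rewrite (negPf xW) andbF.
Qed.

Lemma pext_fun_mem p x : pinjective_in p -> (pext_fun p x \in W) = (x \in W).
Proof.
move=> pP; have [_ _ /subsetP ranW] := pP.
have [xW|xW] := boolP (x \in W); last by rewrite pext_fun_out // (negPf xW).
case px: (p x) => [y|]; last by case: (pext_fun_None pP xW px) => /setDP[].
by rewrite /pext_fun px ranW // (mem_prange px).
Qed.

Lemma pext_fun_inj p : pinjective_in p -> injective (pext_fun p).
Proof.
move=> pP x y eq_xy; have [p_inj _ _] := pP.
have := pext_fun_mem x pP; rewrite eq_xy pext_fun_mem // => yW.
have [xW|xW] := boolP (x \in W); last first.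
  by rewrite -[x](pext_fun_out pP xW) eq_xy pext_fun_out // yW.
rewrite xW in yW; case px: (p x) => [x'|]; case py: (p y) => [y'|].
- move: eq_xy; rewrite /pext_fun px py => eq_xy'.
  by apply: p_inj px _; rewrite eq_xy'.
- have [/setDP[_]] := pext_fun_None pP yW py.
  by rewrite -eq_xy {1}/pext_fun px (mem_prange px).
- have [/setDP[_]] := pext_fun_None pP xW px.
  by rewrite eq_xy {1}/pext_fun py (mem_prange py).
have [_ idx] := pext_fun_None pP xW px; have [_ idy] := pext_fun_None pP yW py.
apply: (index_inj x (s := enum (W :\: pdom p))).
- by rewrite mem_enum !inE px xW.
- by rewrite mem_enum !inE py yW.
by rewrite -idx eq_xy idy.
Qed.

Lemma pextE p : pinjective_in p -> pext p =1 pext_fun p.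
Proof.
move=> /pext_fun_inj inj x.
by rewrite /pext; case: pselect => // inj'; rewrite permE.
Qed.

Lemma pext_Some p x y : pinjective_in p -> p x = Some y -> pext p x = y.
Proof. by move=> pP pxy; rewrite pextE // /pext_fun pxy. Qed.

Lemma pext_mem p x : pinjective_in p -> (pext p x \in W) = (x \in W).
Proof. by move=> pP; rewrite pextE // pext_fun_mem. Qed.

Lemma pext_prange p x : pinjective_in p ->
  (pext p x \in prange p) = (x \in pdom p).
Proof.
move=> pP; apply/prangeP/pdomP => [[y pyx]|[y pxy]]; last first.
  by exists x; rewrite (pext_Some pP pxy).
exists (pext p x); rewrite -pyx; congr (p _).
by apply: (@perm_inj _ (pext p)); rewrite (pext_Some pP pyx).
Qed.

Lemma pinjective_in_comp f g : pinjective_in f -> pinjective_in g ->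
  prange f = pdom g -> pinjective_in (pcomp g f).
Proof.
move=> [f_inj domf _] [g_inj _ rang] fg; split.
- move=> x1 x2 z /pcompP[y1 fx1 gy1] /pcompP[y2 fx2 gy2].
  by rewrite (g_inj _ _ _ gy2 gy1) in fx2; apply: f_inj fx1 fx2.
- by rewrite pdom_comp.
by rewrite prange_comp.
Qed.

Lemma pextM f g : pinjective_in f -> pinjective_in g -> prange f = pdom g ->
  pext (pcomp g f) = (pext f * pext g)%g.
Proof.
move=> fP gP fg; have gfP := pinjective_in_comp fP gP fg.
apply/permP=> x; rewrite permM.
have [xW|xW] := boolP (x \in W); last first.
  by rewrite !pextE // (pext_fun_out fP xW) !pext_fun_out.
case fx: (f x) => [y|].
  have /pdomP[z gyz] : y \in pdom g by rewrite -fg (mem_prange fx).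
  rewrite (pext_Some fP fx) (pext_Some gP gyz); apply: (pext_Some gfP).
  by apply/pcompP; exists y.
rewrite !pextE //; have [/setDP[fxW fx_ran] idx] := pext_fun_None fP xW fx.
have gfx : g (pext_fun f x) = None.
  by move: fx_ran; rewrite fg inE negbK => /eqP.
have gfx' : pcomp g f x = None by rewrite ffunE fx.
rewrite {1}/pext_fun gfx' [in RHS]/pext_fun gfx -fg idx.
rewrite prange_comp // pdom_comp //.
apply: set_nth_default; rewrite -(size_compl_pdom gP) -fg -(size_compl_pdom fP).
by rewrite index_mem mem_enum !inE fx xW.
Qed.

End PartialInjection.

Section Transport.

Variables T U : finType.
Implicit Types (f g : {ffun T -> option T}) (c : T -> option U).

(* [c' o f o c^-1], for partial codings [c] of the domain and [c'] of the range
   of [f]. *)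
Definition transport c c' f : {ffun U -> option U} :=
  [ffun u => [pick u' | [exists x, exists y,
     [&& f x == Some y, c x == Some u & c' y == Some u']]]].

Lemma transportP c c' f u u' : pinjective c ->
  transport c c' f u = Some u' <->
  exists x y, [/\ f x = Some y, c x = Some u & c' y = Some u'].
Proof.
move=> c_inj; rewrite ffunE; case: pickP => [v|none].
  case/existsP=> x /existsP[y /and3P[/eqP fxy /eqP cxu /eqP cyv]].
  split=> [[<-]|[x1 [y1 [fxy1 cxu1 cyu']]]]; first by exists x, y.
  move: fxy1; rewrite (c_inj _ _ _ cxu1 cxu) fxy => -[yy1].
  by rewrite -cyv yy1.
split=> // -[x [y [fxy cxu cyu']]]; have /negP[] := negbT (none u').
by apply/existsP; exists x; apply/existsP; exists y; rewrite fxy cxu cyu' !eqxx.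
Qed.

Lemma transport_inj_in (W : {set U}) c c' f :
  pinjective f -> pinjective c -> pinjective c' ->
  (forall x u, c x = Some u -> u \in W) ->
  (forall y u, c' y = Some u -> u \in W) ->
  pinjective_in W (transport c c' f).
Proof.
move=> f_inj c_inj c'_inj cW c'W; split.
- move=> u1 u2 v /transportP[//|x1 [y1 [fxy1 cx1 cy1]]].
  move=> /transportP[//|x2 [y2 [fxy2 cx2 cy2]]].
  rewrite (c'_inj _ _ _ cy1 cy2) in fxy1.
  by move: cx1; rewrite (f_inj _ _ _ fxy1 fxy2) cx2 => -[].
- by apply/subsetP=> u /pdomP[v /transportP[//|x [y [_ /cW]]]].
by apply/subsetP=> v /prangeP[u /transportP[//|x [y [_ _ /c'W]]]].
Qed.

Definition coded_alike c c' f : Prop :=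
  forall x y, f x = Some y -> (c x : bool) = (c' y : bool).

Lemma transport_prange c c' c'' f g : pinjective c -> pinjective c' ->
  coded_alike c c' f -> coded_alike c' c'' g ->
  prange f = pdom g -> prange (transport c c' f) = pdom (transport c' c'' g).
Proof.
move=> c_inj c'_inj cf cg fg; apply/setP=> u; apply/prangeP/pdomP => -[v].
  case/transportP=> // x [y [fxy cxv cyu]].
  have /pdomP[z gyz] : y \in pdom g by rewrite -fg (mem_prange fxy).
  have := cg _ _ gyz; rewrite cyu; case czw: (c'' z) => [w|//] _.
  by exists w; apply/transportP => //; exists y, z.
case/transportP=> // y [z [gyz cyu _]].
have /prangeP[x fxy] : y \in prange f by rewrite fg (mem_pdom gyz).
have := cf _ _ fxy; rewrite cyu; case cxw: (c x) => [w|//] _.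
by exists w; apply/transportP => //; exists x, y.
Qed.

Lemma transport_comp c c' c'' f g : pinjective c -> pinjective c' ->
  coded_alike c c' f ->
  transport c c'' (pcomp g f) = pcomp (transport c' c'' g) (transport c c' f).
Proof.
move=> c_inj c'_inj cf; apply/ffunP=> u; apply: eq_option => w.
split=> [/transportP[//|x [z [/pcompP[y fxy gyz] cxu czw]]]|].
  have := cf _ _ fxy; rewrite cxu; case cyv: (c' y) => [v|//] _.
  apply/pcompP; exists v; apply/transportP => //; first by exists x, y.
  by exists y, z.
case/pcompP=> v /transportP[//|x [y [fxy cxu cyv]]].
case/transportP=> // y1 [z [gyz cyv1 czw]].
rewrite (c'_inj _ _ _ cyv1 cyv) in gyz.
by apply/transportP => //; exists x, z; split=> //; apply/pcompP; exists y.
Qed.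

End Transport.

(** * Partial automorphisms and valuations *)

Section PartialAutomorphisms.

Variable A : finMetricSpace.

Record pauto := PAuto {
  pauto_map :> {ffun A -> option A};
  pautoP : partial_automorphism pauto_map
}.

Implicit Types f g h : pauto.

Lemma eq_pauto f g : pauto_map f = pauto_map g -> f = g.
Proof.
case: f g => f fP [g gP] /= fg; case: _ / fg in gP *.
by congr PAuto; apply: Prop_irrelevance.
Qed.

Lemma fdist_eq0 (a b : A) : (fdist a b == 0) = (a == b).
Proof. by have [dist0 _ _] := fdist_metric A; apply/eqP/eqP => /dist0. Qed.

Lemma fdistxx (a : A) : fdist a a = 0.
Proof. by apply/eqP; rewrite fdist_eq0. Qed.

Lemma fdist_gt0 (a b : A) : (0 < fdist a b) = (a != b).
Proof. by rewrite lt0n fdist_eq0. Qed.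

Lemma fdistC (a b : A) : fdist a b = fdist b a.
Proof. by have [_ distC _] := fdist_metric A. Qed.

Lemma pauto_inj f : pinjective f.
Proof.
move=> a b c fac fbc; apply/eqP; rewrite -fdist_eq0.
by rewrite -(pautoP fac fbc) fdist_eq0.
Qed.

Lemma partial_automorphism_comp f g : partial_automorphism (pcomp g f).
Proof.
move=> a b a2 b2 /pcompP[a1 fa ga1] /pcompP[b1 fb gb1].
by rewrite (pautoP ga1 gb1) (pautoP fa fb).
Qed.

Definition pauto_comp g f : pauto := PAuto (@partial_automorphism_comp f g).

Record coherent_extension (V : finType) (e : A -> V)
    (ext : pauto -> {perm V}) : Prop := CoherentExtension {
  coh_emb : forall f a b, f a = Some b -> ext f (e a) = e b;
  cohM : forall f g, prange f = pdom g ->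
    ext (pauto_comp g f) = (ext f * ext g)%g
}.

End PartialAutomorphisms.

(* Vertices of [V] are decorated with an element of [W] for every index in [I];
   [twist] says how an extended partial automorphism changes the decoration. *)
Record valuation (A : finMetricSpace) (V I W : finType) (e : A -> V)
    (ext : pauto A -> {perm V}) (act : pauto A -> {perm I})
    (twist : pauto A -> V -> I -> {perm W}) (chi : A -> I -> W) : Prop :=
  Valuation {
  actM : forall f g : pauto A, prange f = pdom g ->
    act (pauto_comp g f) = (act f * act g)%g;
  twist_chi : forall (f : pauto A) a b i, f a = Some b ->
    twist f (e a) i (chi a i) = chi b (act f i);
  twistM : forall (f g : pauto A) x i, prange f = pdom g ->
    twist (pauto_comp g f) x i = (twist f x i * twist g (ext f x) (act f i))%g
}.

Section Valuation.

Variables (A : finMetricSpace) (V I W : finType) (e : A -> V).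
Variables (ext : pauto A -> {perm V}) (act : pauto A -> {perm I}).
Variables (twist : pauto A -> V -> I -> {perm W}) (chi : A -> I -> W).
Implicit Types (f g : pauto A) (u v : V * {ffun I -> W}).

Definition val_emb (a : A) : V * {ffun I -> W} := (e a, [ffun i => chi a i]).

Definition val_act f u : V * {ffun I -> W} :=
  (ext f u.1, [ffun i => let j := (act f)^-1%g i in twist f u.1 j (u.2 j)]).

Lemma val_act_inj f : injective (val_act f).
Proof.
move=> [x F] [y G] [/perm_inj <- /ffunP eqFG]; congr pair; apply/ffunP=> i.
have := eqFG (act f i); rewrite !ffunE !permK.
exact: perm_inj.
Qed.

Definition val_ext f : {perm V * {ffun I -> W}} := perm (@val_act_inj f).

Lemma val_ext1 f u : (val_ext f u).1 = ext f u.1.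
Proof. by rewrite permE. Qed.

Lemma val_ext2 f u i : (val_ext f u).2 (act f i) = twist f u.1 i (u.2 i).
Proof. by rewrite permE ffunE permK. Qed.

Lemma eq_valuation f u v : u.1 = v.1 ->
  (forall i, u.2 (act f i) = v.2 (act f i)) -> u = v.
Proof.
case: u v => [x F] [y G] /= -> eqFG; congr pair; apply/ffunP=> i.
by rewrite -(permKV (act f) i).
Qed.

Lemma val_coherent : coherent_extension e ext ->
  valuation e ext act twist chi -> coherent_extension val_emb val_ext.
Proof.
move=> extP valP; split=> [f a b fab|f g fg].
  apply: (@eq_valuation f) => [|i].
    by rewrite val_ext1 (coh_emb extP fab).
  by rewrite val_ext2 !ffunE (twist_chi valP _ fab).
apply/permP=> u; rewrite permM; apply: (@eq_valuation (pauto_comp g f)) => [|i].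
  by rewrite !val_ext1 (cohM extP fg) permM.
rewrite val_ext2 (actM valP fg) permM val_ext2 val_ext1 val_ext2.
by rewrite (twistM valP _ _ fg) permM.
Qed.

End Valuation.

(** * Edge-labelled EPPA-witnesses *)

(* The label [0] stands for a non-edge. *)
Record lgraph (delta : nat) := LGraph {
  lvertex :> finType;
  label : lvertex -> lvertex -> nat;
  labelC : forall u v, label u v = label v u;
  labelxx : forall u, label u u = 0;
  label_le : forall u v, label u v <= delta
}.

Arguments label {delta l} u v.

Section LabelledGraphs.

Variables (delta : nat) (G : lgraph delta).
Implicit Types (u v : G) (Q : {set G}).

Definition adj : rel G := fun u v => 0 < label u v.

Lemma adjC u v : adj u v = adj v u.
Proof. by rewrite /adj labelC. Qed.

Lemma adjxx u : adj u u = false.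
Proof. by rewrite /adj labelxx. Qed.

Lemma adj_neq u v : adj u v -> u != v.
Proof. by apply: contraTneq => ->; rewrite adjxx. Qed.

Definition clique Q : Prop := {in Q &, forall u v, u != v -> adj u v}.

Definition embeddable (A : finMetricSpace) Q : bool :=
  [exists j : {ffun G -> A}, [forall u in Q, forall v in Q,
     (u != v) ==> (fdist (j u) (j v) == label u v)]].

Lemma embeddableP (A : finMetricSpace) Q :
  reflect (exists j : G -> A,
             {in Q &, forall u v, u != v -> fdist (j u) (j v) = label u v})
          (embeddable A Q).
Proof.
apply: (iffP existsP) => [[j /forall_inP jP]|[j jP]].
  exists j => u v uQ vQ uv; apply/eqP.
  by have /forall_inP/(_ _ vQ)/implyP := jP _ uQ; apply.
exists [ffun u => j u]; apply/forall_inP=> u uQ; apply/forall_inP=> v vQ.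
by apply/implyP=> uv; rewrite !ffunE; apply/eqP/jP.
Qed.

End LabelledGraphs.

Arguments adj {delta G} u v.

Record witness (A : finMetricSpace) (delta : nat) := Witness {
  wgraph :> lgraph delta;
  wemb : A -> wgraph;
  wext : pauto A -> {perm wgraph};
  wext_coherent : coherent_extension wemb wext;
  label_emb : forall a b, label (wemb a) (wemb b) = fdist a b;
  label_ext : forall f u v, label (wext f u) (wext f v) = label u v
}.

Arguments wemb {A delta} w.
Arguments wext {A delta} w.

Section Witnesses.

Variables (A : finMetricSpace) (delta : nat) (B : witness A delta).
Implicit Types (f g : pauto A) (a b : A) (u v : B).

Lemma adj_emb a b : adj (wemb B a) (wemb B b) = (a != b).
Proof. by rewrite /adj label_emb fdist_gt0. Qed.

Lemma wemb_inj : injective (wemb B).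
Proof.
by move=> a b eq_ab; apply/eqP; rewrite -fdist_eq0 -(label_emb B) eq_ab labelxx.
Qed.

Lemma wext_emb f a b : f a = Some b -> wext B f (wemb B a) = wemb B b.
Proof. exact: (coh_emb (wext_coherent B)). Qed.

Lemma wextM f g : prange f = pdom g ->
  wext B (pauto_comp g f) = (wext B f * wext B g)%g.
Proof. exact: (cohM (wext_coherent B)). Qed.

Lemma embeddable_ext f (Q : {set B}) :
  embeddable A (wext B f @: Q) = embeddable A Q.
Proof.
apply/embeddableP/embeddableP => -[j jP].
  exists (j \o wext B f) => u v uQ vQ uv /=.
  by rewrite jP ?imset_f ?(inj_eq perm_inj) // label_ext.
exists (j \o (wext B f)^-1%g) => _ _ /imsetP[u uQ ->] /imsetP[v vQ ->].
by rewrite (inj_eq perm_inj) label_ext /= !permK; apply: jP.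
Qed.

Definition faithful_cliques : Prop := forall Q : {set B}, clique Q ->
  embeddable A Q.

End Witnesses.

Record compatibility (A : finMetricSpace) (delta : nat) (B : witness A delta)
    (I W : finType) (act : pauto A -> {perm I})
    (twist : pauto A -> B -> I -> {perm W}) (chi : A -> I -> W)
    (compat : I -> rel (B * W)) : Prop := Compatibility {
  compatC : forall i, symmetric (compat i);
  compat_act : forall f i x y w z,
    compat (act f i) (wext B f x, twist f x i w) (wext B f y, twist f y i z) =
    compat i (x, w) (y, z);
  compat_chi : forall i a b, a != b ->
    compat i (wemb B a, chi a i) (wemb B b, chi b i)
}.

Lemma forall_perm (I : finType) (s : {perm I}) (P : pred I) :
  [forall i, P (s i)] = [forall i, P i].
Proof.
apply/forallP/forallP => PI i //.
by rewrite -(permKV s i).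
Qed.

Section Lift.

Variables (A : finMetricSpace) (delta : nat) (B : witness A delta).
Variables (I W : finType) (act : pauto A -> {perm I}).
Variables (twist : pauto A -> B -> I -> {perm W}) (chi : A -> I -> W).
Variable compat : I -> rel (B * W).
Hypothesis valP : valuation (wemb B) (wext B) act twist chi.
Hypothesis compatP : compatibility act twist chi compat.

Local Notation decorated := (B * {ffun I -> W})%type.
Implicit Types u v : decorated.

Definition compatible u v : bool :=
  [forall i, compat i (u.1, u.2 i) (v.1, v.2 i)].

Definition lift_label u v : nat := if compatible u v then label u.1 v.1 else 0.

Lemma lift_labelC u v : lift_label u v = lift_label v u.
Proof.
rewrite /lift_label labelC; congr (if _ then _ else _).
by apply: eq_forallb => i; rewrite (compatC compatP).
Qed.

Lemma lift_labelxx u : lift_label u u = 0.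
Proof. by rewrite /lift_label labelxx if_same. Qed.

Lemma lift_label_le u v : lift_label u v <= delta.
Proof. by rewrite /lift_label; case: ifP => // _; apply: label_le. Qed.

Definition lift_graph : lgraph delta :=
  @LGraph delta decorated lift_label lift_labelC lift_labelxx lift_label_le.

Lemma lift_label_emb a b :
  lift_label (val_emb (wemb B) chi a) (val_emb (wemb B) chi b) = fdist a b.
Proof.
rewrite /lift_label /= label_emb; have [->|ab] := eqVneq a b.
  by rewrite fdistxx if_same.
suff -> : compatible (val_emb (wemb B) chi a) (val_emb (wemb B) chi b) by [].
by apply/forallP=> i; rewrite !ffunE; apply: (compat_chi compatP).
Qed.

Lemma lift_label_ext f u v :
  lift_label (val_ext (wext B) act twist f u) (val_ext (wext B) act twist f v) =
  lift_label u v.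
Proof.
rewrite /lift_label !val_ext1 label_ext; congr (if _ then _ else _).
rewrite /compatible -(forall_perm (act f)); apply: eq_forallb => i.
by rewrite !val_ext1 !val_ext2 (compat_act compatP).
Qed.

Definition lift_witness : witness A delta :=
  @Witness A delta lift_graph _ _ (val_coherent (wext_coherent B) valP)
    lift_label_emb lift_label_ext.

Lemma adj_lift (u v : lift_witness) : adj u v ->
  label u v = label u.1 v.1 /\ forall i, compat i (u.1, u.2 i) (v.1, v.2 i).
Proof. by rewrite /adj /= /lift_label; case: ifP => // /forallP. Qed.

Lemma adj_lift1 (u v : lift_witness) : adj u v -> adj u.1 v.1.
Proof.
by move=> uv; have [eq_label _] := adj_lift uv; rewrite /adj -eq_label.
Qed.

Section LiftedClique.

Variable Q : {set lift_witness}.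
Hypothesis cliqueQ : clique Q.

Lemma lift_clique_inj : {in Q &, injective fst}.
Proof.
move=> u v uQ vQ eq_uv; apply/eqP; apply: contraT => /(cliqueQ uQ vQ)/adj_lift1.
by rewrite eq_uv adjxx.
Qed.

Lemma lift_clique : clique (fst @: Q).
Proof.
move=> _ _ /imsetP[u uQ ->] /imsetP[v vQ ->] uv; apply/adj_lift1/cliqueQ => //.
by apply: contraNneq uv => ->.
Qed.

Lemma lift_embeddable : embeddable A (fst @: Q) -> embeddable A Q.
Proof.
case/embeddableP=> j jP; apply/embeddableP; exists (j \o fst) => u v uQ vQ uv.
have uv_adj := cliqueQ uQ vQ uv; have [-> _] := adj_lift uv_adj.
by rewrite /= jP ?imset_f ?(adj_neq (adj_lift1 uv_adj)).
Qed.

End LiftedClique.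

Lemma lift_faithful_cliques :
  faithful_cliques B -> faithful_cliques lift_witness.
Proof.
by move=> faithful Q cliqueQ; apply/lift_embeddable/faithful/lift_clique.
Qed.

End Lift.

Section BaseWitness.

Variables (A : finMetricSpace) (delta : nat).
Hypothesis fdist_le : forall a b : A, fdist a b <= delta.

Local Open Scope ring_scope.
Local Notation Z := 'I_delta.+1.
Implicit Types (f g : pauto A) (a b x y : A).

Definition base_chi a b : Z :=
  if (enum_rank a < enum_rank b)%N then inord (fdist a b) else 0.

Lemma base_chiD a b : a != b ->
  base_chi a b + base_chi b a = inord (fdist a b) :> Z.
Proof.
move=> ab; rewrite /base_chi.
case: ltngtP => [_|_|/val_inj/enum_rank_inj eq_ab].
- by rewrite addr0.
- by rewrite add0r fdistC.
by rewrite eq_ab eqxx in ab.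
Qed.

Definition base_ext f : {perm A} := pext [set: A] f.

Lemma pinjective_in_setT f : pinjective_in [set: A] f.
Proof. by split; rewrite ?subsetT //; apply: pauto_inj. Qed.

Lemma base_ext_Some f a b : f a = Some b -> base_ext f a = b.
Proof. by apply: pext_Some; apply: pinjective_in_setT. Qed.

Lemma base_extM f g : prange f = pdom g ->
  base_ext (pauto_comp g f) = (base_ext f * base_ext g)%g.
Proof. by move=> fg; apply: pextM => //; apply: pinjective_in_setT. Qed.

Lemma base_ext_pdom f g x : prange f = pdom g ->
  (base_ext f x \in pdom g) = (x \in pdom f).
Proof. by move=> <-; apply/pext_prange/pinjective_in_setT. Qed.

Definition base_diff f x y : Z :=
  base_chi (base_ext f x) (base_ext f y) - base_chi x y.

Definition base_shift f x y : Z :=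
  if x \in pdom f then base_diff f x y
  else if y \in pdom f then - base_diff f y x else 0.

Lemma base_shift_anti f x y : x != y -> base_shift f x y + base_shift f y x = 0.
Proof.
move=> xy; rewrite /base_shift.
case: (boolP (x \in pdom f)) => xf; case: (boolP (y \in pdom f)) => yf;
  rewrite ?subrr ?addNr ?addr0 //.
have [[x' fx] [y' fy]] := (pdomP _ _ xf, pdomP _ _ yf).
rewrite /base_diff addrACA -opprD !base_chiD ?(inj_eq perm_inj) //.
by rewrite (base_ext_Some fx) (base_ext_Some fy) (pautoP fx fy) subrr.
Qed.

Lemma base_diff_comp f g x y : prange f = pdom g ->
  base_diff (pauto_comp g f) x y =
  base_diff f x y + base_diff g (base_ext f x) (base_ext f y).
Proof.
by move=> fg; rewrite /base_diff base_extM // !permM [RHS]addrC addrA subrK.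
Qed.

Lemma base_shift_comp f g x y : prange f = pdom g ->
  base_shift (pauto_comp g f) x y =
  base_shift f x y + base_shift g (base_ext f x) (base_ext f y).
Proof.
move=> fg; rewrite /base_shift pdom_comp // !base_diff_comp //.
rewrite !(base_ext_pdom _ fg).
by do 2!case: ifP => _ //; rewrite ?addr0 ?opprD.
Qed.

Definition base_twist f x y : {perm Z} := perm (@addIr Z (base_shift f x y)).

Lemma base_twistE f x y w : base_twist f x y w = w + base_shift f x y.
Proof. by rewrite permE. Qed.

Lemma base_valuation : valuation id base_ext base_ext base_twist base_chi.
Proof.
split=> [f g|f a b x fab|f g x y fg]; first exact: base_extM.
  rewrite base_twistE /base_shift (mem_pdom fab) /base_diff (base_ext_Some fab).
  by rewrite addrC subrK.
by apply/permP=> w; rewrite permM !base_twistE base_shift_comp // addrA.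
Qed.

Lemma base_coherent : coherent_extension (val_emb id base_chi)
  (val_ext base_ext base_ext base_twist).
Proof.
apply: val_coherent base_valuation; split=> [f a b|f g];
  first exact: base_ext_Some.
exact: base_extM.
Qed.

Definition base_label (u v : A * {ffun A -> Z}) : nat :=
  if u.1 == v.1 then 0%N else nat_of_ord (u.2 v.1 + v.2 u.1).

Lemma base_labelC u v : base_label u v = base_label v u.
Proof. by rewrite /base_label eq_sym addrC. Qed.

Lemma base_labelxx u : base_label u u = 0%N.
Proof. by rewrite /base_label eqxx. Qed.

Lemma base_label_le u v : (base_label u v <= delta)%N.
Proof. by rewrite /base_label; case: ifP => // _; rewrite -ltnS ltn_ord. Qed.

Lemma base_label_emb a b :
  base_label (val_emb id base_chi a) (val_emb id base_chi b) = fdist a b.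
Proof.
rewrite /base_label /=; have [->|ab] := eqVneq a b; first by rewrite fdistxx.
by have /(congr1 val) /= := base_chiD ab; rewrite !ffunE => ->;
  rewrite inordK // ltnS.
Qed.

Lemma base_label_ext f u v :
  base_label (val_ext base_ext base_ext base_twist f u)
    (val_ext base_ext base_ext base_twist f v) = base_label u v.
Proof.
rewrite /base_label !val_ext1 (inj_eq perm_inj).
case: ifPn => // uv.
by rewrite !val_ext2 !base_twistE addrACA base_shift_anti // addr0.
Qed.

Definition base_witness : witness A delta :=
  @Witness A delta (LGraph base_labelC base_labelxx base_label_le) _ _
    base_coherent base_label_emb base_label_ext.

End BaseWitness.

(** * Unwinding unfaithful cliques *)

Section CliqueStep.

Variables (A : finMetricSpace) (delta : nat) (B : witness A delta) (j0 : B ->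
  A).
Implicit Types (f g : pauto A) (M : {set B}) (a b : A) (x : B).

Local Notation W := 'I_#|B|.+1.

Definition bad_set M : bool := ~~ embeddable A M.

(* A bad set receives one value fewer than it has elements, so it cannot lift
   to a clique. *)
Definition clique_vals M : {set W} := [set w : W | w < #|M|.-1].

Definition clique_code M a : option W :=
  if bad_set M && (wemb B a \in M)
  then Some (inord (index (wemb B a) (enum (M :&: wemb B @: A)))) else None.

Definition clique_chi a M : W := odflt ord0 (clique_code M a).

Lemma bad_set_gt1 M : bad_set M -> 1 < #|M|.
Proof.
apply: contraR; rewrite -leqNgt => /card_le1_eqP M_le1; apply/embeddableP.
by exists j0 => u v uM vM; rewrite (M_le1 _ _ uM vM) eqxx.
Qed.

Lemma embeddable_sub_emb M : M \subset wemb B @: A -> embeddable A M.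
Proof.
move=> /subsetP subM; pose j x := odflt (j0 x) [pick a | wemb B a == x].
have jE a : j (wemb B a) = a.
  by rewrite /j; case: pickP => [b /eqP/wemb_inj|/(_ a)]; rewrite ?eqxx.
apply/embeddableP; exists j => _ _ /subM/imsetP[a _ ->] /subM/imsetP[b _ ->] _.
by rewrite !jE label_emb.
Qed.

Lemma bad_set_card M : bad_set M -> #|M :&: wemb B @: A| <= #|M|.-1.
Proof.
move=> badM; have := bad_set_gt1 badM.
suff /proper_card : M :&: wemb B @: A \proper M by lia.
rewrite properE subsetIl; apply: contra badM => /subset_trans subM.
by apply/embeddable_sub_emb/subM/subsetIr.
Qed.

Lemma clique_code_Some M a w : clique_code M a = Some w ->
  [/\ bad_set M, wemb B a \in enum (M :&: wemb B @: A)
    & w = index (wemb B a) (enum (M :&: wemb B @: A)) :> nat].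
Proof.
rewrite /clique_code; case: ifP => // /andP[badM aM] [<-].
rewrite mem_enum inE aM imset_f //; split=> //; rewrite inordK // ltnS.
by apply: leq_trans (index_size _ _) _; rewrite -cardE; apply: max_card.
Qed.

Lemma clique_code_vals M a w : clique_code M a = Some w -> w \in clique_vals M.
Proof.
case/clique_code_Some=> badM aM idx; rewrite inE idx.
by apply: leq_trans (bad_set_card badM); rewrite cardE index_mem.
Qed.

Lemma clique_code_inj M : pinjective (clique_code M).
Proof.
move=> a b w /clique_code_Some[_ aM idx] /clique_code_Some[_ bM].
by rewrite idx => /(index_inj (wemb B a) aM bM)/wemb_inj.
Qed.

Definition set_ext f : {perm {set B}} :=
  perm (imset_inj (@perm_inj _ (wext B f))).

Lemma set_extE f M : set_ext f M = wext B f @: M.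
Proof. by rewrite permE. Qed.

Lemma mem_set_ext f M x : (wext B f x \in set_ext f M) = (x \in M).
Proof. by rewrite set_extE mem_imset //; apply: perm_inj. Qed.

Lemma set_extM f g : prange f = pdom g ->
  set_ext (pauto_comp g f) = (set_ext f * set_ext g)%g.
Proof.
move=> fg; apply/permP=> M; rewrite permM !set_extE -imset_comp.
by apply: eq_imset => x; rewrite wextM // permM.
Qed.

Lemma bad_set_ext f M : bad_set (set_ext f M) = bad_set M.
Proof. by rewrite /bad_set set_extE embeddable_ext. Qed.

Lemma clique_vals_ext f M : clique_vals (set_ext f M) = clique_vals M.
Proof. by rewrite /clique_vals set_extE card_imset //; apply: perm_inj. Qed.

Definition clique_pmap f M : {ffun W -> option W} :=
  transport (clique_code M) (clique_code (set_ext f M)) f.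

Definition clique_twist f x M : {perm W} :=
  if bad_set M && (x \in M) then pext (clique_vals M) (clique_pmap f M) else
    1%g.

Lemma clique_pmap_inj f M : pinjective_in (clique_vals M) (clique_pmap f M).
Proof.
apply: transport_inj_in; try exact: clique_code_inj; try exact: pauto_inj.
  by move=> a w; apply: clique_code_vals.
by move=> a w /clique_code_vals; rewrite clique_vals_ext.
Qed.

Lemma clique_code_alike f M :
  coded_alike (clique_code M) (clique_code (set_ext f M)) f.
Proof.
move=> a b fab; rewrite /clique_code bad_set_ext -(wext_emb B fab) mem_set_ext.
by case: ifP.
Qed.

Lemma clique_valuation :
  valuation (wemb B) (wext B) set_ext clique_twist clique_chi.
Proof.
split=> [f g|f a b M fab|f g x M fg]; first exact: set_extM.
  have := clique_code_alike M fab; rewrite /clique_twist /clique_chi.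
  case aw: (clique_code M a) => [w|]; case bz: (clique_code _ b) => [z|] //= _.
    have [-> /= aM _] := clique_code_Some aw.
    move: aM; rewrite mem_enum => /setIP[-> _].
    apply: pext_Some; first exact: clique_pmap_inj.
    by apply/transportP; [apply: clique_code_inj | exists a, b].
  by move: aw; rewrite /clique_code; case: ifP; rewrite ?perm1.
rewrite /clique_twist bad_set_ext mem_set_ext clique_vals_ext.
case: (bad_set M && (x \in M)); last by rewrite mulg1.
have alike_f := clique_code_alike (f := f) M.
have alike_g := clique_code_alike (f := g) (set_ext f M).
rewrite -pextM.
- congr pext; rewrite /clique_pmap set_extM // permM.
  by apply: transport_comp; try exact: clique_code_inj.
- exact: clique_pmap_inj.
- by rewrite -(clique_vals_ext f); apply: clique_pmap_inj.
by apply: transport_prange; try exact: clique_code_inj.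
Qed.

Definition clique_compat M : rel (B * W) := fun u v =>
  [&& bad_set M, u.1 \in M & v.1 \in M] ==>
  [&& u.2 != v.2, u.2 \in clique_vals M & v.2 \in clique_vals M].

Lemma clique_compatibility :
  compatibility set_ext clique_twist clique_chi clique_compat.
Proof.
split=> [M u v|f M x y w z|M a b ab].
- by rewrite /clique_compat eq_sym (andbC (u.1 \in M)) (andbC (u.2 \in _)).
- rewrite /clique_compat /= /clique_twist bad_set_ext !mem_set_ext
    clique_vals_ext.
  case: (boolP (bad_set M)) => //= badM.
  case: (boolP (x \in M)) => //= xM; case: (boolP (y \in M)) => //= yM.
  have pmap_inj := clique_pmap_inj f M.
  by rewrite (inj_eq perm_inj) !(pext_mem _ pmap_inj).
apply/implyP=> /and3P[/= badM aM bM]; rewrite /clique_chi.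
case aw: (clique_code M a) => [w|]; last by rewrite /clique_code badM aM in aw.
case bz: (clique_code M b) => [z|]; last by rewrite /clique_code badM bM in bz.
rewrite /= (clique_code_vals aw) (clique_code_vals bz) !andbT.
by apply: contraNneq ab => wz; rewrite wz in aw;
  rewrite (clique_code_inj aw bz).
Qed.

Definition clique_witness : witness A delta :=
  lift_witness clique_valuation clique_compatibility.

Lemma card_clique_vals M : #|clique_vals M| <= #|M|.-1.
Proof.
rewrite cardE -(size_map val) -[leqRHS](size_iota 0).
apply: uniq_leq_size; first by rewrite (map_inj_uniq val_inj) enum_uniq.
by move=> x /mapP[w]; rewrite mem_enum inE => wM ->; rewrite mem_iota.
Qed.

Lemma clique_witness_faithful : faithful_cliques clique_witness.
Proof.
move=> Q cliqueQ; have cardM := card_in_imset (lift_clique_inj cliqueQ).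
apply: (lift_embeddable cliqueQ); apply: contraT; rewrite -/(bad_set _) => badM.
set M := (fst @: Q) in cardM badM; pose val_M (u : clique_witness) := u.2 M.
have memM (u : clique_witness) : u \in Q -> u.1 \in M by exact: imset_f.
have compatQ (u v : clique_witness) : u \in Q -> v \in Q -> u != v ->
    [&& val_M u != val_M v,
      val_M u \in clique_vals M & val_M v \in clique_vals M].
  move=> uQ vQ uv; have [_ /(_ M)/implyP] := adj_lift (cliqueQ u v uQ vQ uv).
  by apply; rewrite badM !memM.
have M_gt1 := bad_set_gt1 badM.
have sub_vals : val_M @: Q \subset clique_vals M.
  apply/subsetP=> _ /imsetP[u uQ ->].
  have /card_gt0P[v] : 0 < #|Q :\ u| by move: M_gt1;
    rewrite cardM (cardsD1 u Q) uQ.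
  by case/setD1P=> vu vQ; have /and3P[] := compatQ v u vQ uQ vu.
have val_inj : {in Q &, injective val_M}.
  move=> u v uQ vQ eq_uv; apply/eqP; apply: contraT.
  by case/(compatQ u v uQ vQ)/and3P; rewrite eq_uv eqxx.
have := leq_trans (subset_leq_card sub_vals) (card_clique_vals M).
by rewrite (card_in_imset val_inj) -cardM; lia.
Qed.

End CliqueStep.

(** * Unwinding bad closed walks *)

Definition labels_in (delta : nat) : pred (seq nat) :=
  all (fun a => 0 < a <= delta).

(* [good_glue] merges two closed walks along a common chord [c]; the label [0]
   in [good_zero] makes a repeated vertex a chord as well. *)
Record word_class (delta : nat) (good : pred (seq nat)) : Prop := WordClass {
  good_nil : good [::];
  good_pair : forall a, good [:: a; a];
  good_rot : forall w1 w2, good (w1 ++ w2) -> good (w2 ++ w1);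
  good_zero : forall w, labels_in delta w -> good w -> good (0 :: w);
  good_glue : forall c w1 w2, labels_in delta w1 -> labels_in delta w2 ->
    good (c :: w1) -> good (c :: w2) -> good (w1 ++ w2);
  good_long : exists N, forall w, labels_in delta w -> N < size w -> good w
}.

Lemma cycle_nth (T : Type) (e : rel T) (x0 : T) (t : seq T) i :
  cycle e t -> i.+1 < size t -> e (nth x0 t i) (nth x0 t i.+1).
Proof.
case: t => // x p; rewrite [cycle _ _]/= rcons_path => /andP[/(pathP x0) + _].
exact.
Qed.

Lemma cycle_last_head (T : Type) (e : rel T) (x0 : T) (t : seq T) :
  cycle e t -> 0 < size t -> e (nth x0 t (size t).-1) (nth x0 t 0).
Proof.
case: t => // x p; rewrite [cycle _ _]/= rcons_path => /andP[_].
by rewrite (last_nth x0).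
Qed.

Lemma cycle_catC (T : Type) (e : rel T) (s1 s2 : seq T) :
  cycle e (s1 ++ s2) = cycle e (s2 ++ s1).
Proof. by rewrite -rot_size_cat rot_cycle. Qed.

Lemma cat_two_nth (T : Type) (x0 : T) (s : seq T) i j : i < j < size s ->
  exists s1 s2 s3, [/\ s = s1 ++ (nth x0 s i :: s2) ++ nth x0 s j :: s3,
    size s1 = i, (size s2).+1 = j - i & (size s3).+1 = size s - j].
Proof.
move=> /andP[ij js]; pose k := j - i.+1.
exists (take i s), (take k (drop i.+1 s)), (drop j.+1 s); split.
- have -> : nth x0 s j :: drop j.+1 s = drop k (drop i.+1 s).
    by rewrite drop_drop addnC -[_ + k]/(i.+1 + (j - i.+1)) subnKC // -drop_nth.
  by rewrite cat_cons cat_take_drop -drop_nth ?cat_take_drop //; lia.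
- by rewrite size_take; case: ifP => //; lia.
- by rewrite size_takel ?size_drop /k; lia.
by rewrite size_drop; lia.
Qed.

Section ClosedWalks.

Variables (delta : nat) (G : lgraph delta).
Implicit Types (x y : G) (p q t : seq G).

Definition cyc_labels t : seq nat :=
  if t is x :: p then pairmap label x (rcons p x) else [::].

Lemma cyc_labels_cat x p y q :
  cyc_labels ((x :: p) ++ y :: q) =
  pairmap label x (rcons p y) ++ pairmap label y (rcons q x).
Proof. by rewrite /= rcons_cat -cat_rcons pairmap_cat last_rcons. Qed.

Lemma path_labels x p : path adj x p -> labels_in delta (pairmap label x p).
Proof.
elim: p x => //= y p IHp x /andP[xy yp].
by rewrite -/(labels_in _ _) IHp // andbT label_le andbT.
Qed.

Lemma cyc_labels_in t : cycle adj t -> labels_in delta (cyc_labels t).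
Proof. by case: t => // x p; apply: path_labels. Qed.

Lemma size_cyc_labels t : size (cyc_labels t) = size t.
Proof. by case: t => // x p; rewrite /= size_pairmap size_rcons. Qed.

Variable good : pred (seq nat).
Hypothesis goodP : word_class delta good.

Definition good_graph : Prop :=
  forall t, cycle adj t -> good (cyc_labels t).

Definition bad_cycle t : bool := cycle adj t && ~~ good (cyc_labels t).

Lemma bad_cycle_catC t1 t2 : bad_cycle (t1 ++ t2) -> bad_cycle (t2 ++ t1).
Proof.
rewrite /bad_cycle cycle_catC => /andP[-> /=]; apply: contra.
case: t1 t2 => [|x p] [|y q]; rewrite ?cats0 // !cyc_labels_cat.
exact: (good_rot goodP).
Qed.

Section ShortestBadCycle.

Variable n : nat.
Hypothesis good_lt : forall t, cycle adj t -> size t < n ->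
  good (cyc_labels t).

Lemma good_closing x p y : path adj x (rcons p y) -> (x == y) || adj x y ->
  size p + 2 < n -> good (label x y :: pairmap label x (rcons p y)).
Proof.
move=> xp /orP[/eqP eq_xy|xy] szp.
  rewrite eq_xy labelxx in xp *.
  apply: (good_zero goodP); first exact: path_labels.
  by apply: (@good_lt (y :: p)) => //=; lia.
rewrite -cat1s; apply: (good_rot goodP).
have /= := @good_lt (x :: rcons p y).
rewrite -[X in pairmap _ _ X]cats1 pairmap_cat /= last_rcons labelC; apply.
  by rewrite rcons_path xp last_rcons adjC.
by rewrite size_rcons; lia.
Qed.

Lemma good_chord x p y q : cycle adj ((x :: p) ++ y :: q) ->
  (x == y) || adj x y -> size p + 2 < n -> size q + 2 < n ->
  good (cyc_labels ((x :: p) ++ y :: q)).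
Proof.
rewrite cyc_labels_cat /= rcons_cat /= -cat_rcons cat_path last_rcons.
move=> /andP[xp yq] xy szp szq.
apply: (good_glue goodP (c := label x y)); try exact: path_labels.
  exact: good_closing.
by rewrite labelC; apply: good_closing => //; rewrite eq_sym adjC.
Qed.

Lemma bad_cycle_chordless x0 t i j : bad_cycle t -> size t = n ->
  i.+1 < j < n -> (j - i).+1 < n ->
  ~~ ((nth x0 t i == nth x0 t j) || adj (nth x0 t i) (nth x0 t j)).
Proof.
move=> bad_t szt /andP[ij jn] ji; have ij_t : i < j < size t by lia.
have [s1 [s2 [s3 [eq_t sz1 sz2 sz3]]]] := cat_two_nth x0 ij_t.
move: bad_t; rewrite {1}eq_t => /bad_cycle_catC; rewrite -catA cat_cons.
case/andP=> cyc; apply: contra => xy; apply: good_chord => //; first lia.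
by rewrite size_cat; lia.
Qed.

Lemma bad_cycle_uniq t : bad_cycle t -> size t = n -> uniq t.
Proof.
move=> bad_t szt; have /andP[cyc _] := bad_t.
apply: contraT => not_uniq; have [x0 _] : exists x0, x0 \in t.
  by case: t not_uniq {bad_t szt cyc} => // x0 p; exists x0; rewrite mem_head.
have [i [j [ij jt eq_ij]]] := uniqPn x0 not_uniq; rewrite szt in jt.
have := bad_cycle_chordless x0 (i := i) (j := j) bad_t szt.
rewrite eq_ij eqxx => chordless.
have [eq_j|j_neq] := eqVneq j i.+1.
  have := cycle_nth x0 (i := i) cyc.
  by rewrite szt -eq_j jt eq_ij adjxx => /(_ isT).
have [far|[i0 jn]] : (j - i).+1 < n \/ i = 0 /\ j = n.-1 by lia.
  by have /chordless/(_ far) : i.+1 < j < n by lia.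
by have := cycle_last_head x0 cyc; rewrite szt -jn -eq_ij i0 adjxx; lia.
Qed.

Lemma bad_cycle_adj t x y : bad_cycle t -> size t = n -> x \in t -> y \in t ->
  adj x y -> index x t < index y t ->
  index y t = (index x t).+1 \/ index x t = 0 /\ (index y t).+1 = n.
Proof.
move=> bad_t szt xt yt xy lt_xy.
have := bad_cycle_chordless x (i := index x t) (j := index y t) bad_t szt.
rewrite !nth_index // xy orbT; have : index y t < n by rewrite -szt index_mem.
by move=> ? chordless; lia.
Qed.

End ShortestBadCycle.

End ClosedWalks.

Section LabelMorphisms.

Variables (delta : nat) (G H : lgraph delta) (h : G -> H).

Definition edge_label_preserving : Prop :=
  forall u v, adj u v -> label (h u) (h v) = label u v.

Hypothesis hP : edge_label_preserving.

Lemma map_walk x p : path adj x p ->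
  path adj (h x) (map h p) /\
  pairmap label (h x) (map h p) = pairmap label x p.
Proof.
elim: p x => //= y p IHp x /andP[xy /IHp[-> ->]].
by rewrite /adj (hP xy) andbT.
Qed.

Lemma map_bad_cycle good t : bad_cycle good t -> bad_cycle good (map h t).
Proof.
case: t => //= x p /andP[/map_walk[cyc eq_labels] bad_labels].
by rewrite /bad_cycle /= -map_rcons eq_labels cyc.
Qed.

End LabelMorphisms.

Section CycleStep.

Variables (A : finMetricSpace) (delta : nat) (good : pred (seq nat)).
Hypothesis goodP : word_class delta good.
Variables (B : witness A delta) (n : nat).
Hypothesis n_gt3 : 3 < n.
Hypothesis good_lt : forall t : seq B, cycle adj t -> size t < n ->
  good (cyc_labels t).
Implicit Types (f g : pauto A) (t : n.-tuple B) (a b : A) (x y : B).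

(* A tuple is a cycle together with its distinguished closing edge, across
   which the valuation has to change; rotations give the other choices. *)
Definition closing t x y : bool :=
  (index x t == 0) && (index y t == n.-1) ||
  (index x t == n.-1) && (index y t == 0).

Lemma closingC t x y : closing t x y = closing t y x.
Proof. by rewrite /closing orbC andbC [X in _ || X]andbC. Qed.

Definition cycle_chi a t : bool :=
  [&& bad_cycle good t, index (wemb B a) t == 0
    & [exists b, index (wemb B b) t == n.-1]].

Lemma index_tuple_lt t x : (index x t < n) = (x \in t).
Proof. by rewrite -{2}(size_tuple t) index_mem. Qed.

(* A minimal bad cycle is induced and has length at least 4, hence contains no
   three vertices of the complete copy of [A]. *)
Lemma cycle_chiD t a b : bad_cycle good t -> wemb B a \in t -> wemb B b \in t ->
  a != b -> cycle_chi a t (+) cycle_chi b t = closing t (wemb B a) (wemb B b).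
Proof.
move=> bad_t.
have adj_index c d : c != d -> wemb B c \in t -> wemb B d \in t ->
    index (wemb B c) t < index (wemb B d) t ->
    index (wemb B d) t = (index (wemb B c) t).+1 \/
    index (wemb B c) t = 0 /\ (index (wemb B d) t).+1 = n.
  move=> cd c_t d_t lt_cd.
  by apply: (bad_cycle_adj goodP good_lt bad_t); rewrite ?size_tuple ?adj_emb.
wlog lt_ab : a b / index (wemb B a) t < index (wemb B b) t.
  move=> lt_case a_t b_t ab.
  have [/lt_case|/lt_case|] := ltngtP (index (wemb B a) t) (index (wemb B b) t).
  - exact.
  - by rewrite addbC closingC eq_sym; apply.
  by move/(index_inj (wemb B a) a_t b_t)/wemb_inj => eq_ab; case/eqP: ab.
move=> a_t b_t ab; have adj_ab := adj_index _ _ ab a_t b_t lt_ab.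
have b_lt : index (wemb B b) t < n by rewrite index_tuple_lt.
have b_neq0 : (index (wemb B b) t == 0) = false by lia.
rewrite /cycle_chi /closing bad_t b_neq0 /= addbF andbF orbF.
case: eqP => //= a0; apply/existsP/eqP => [[c /eqP idx_c]|idx_b].
  have c_t : wemb B c \in t by rewrite -index_tuple_lt; lia.
  have [-> //|bc] := eqVneq b c.
  by have := adj_index _ _ bc b_t c_t; lia.
by exists b; rewrite idx_b.
Qed.

Lemma tuple_ext_inj f : injective (fun t => map_tuple (wext B f) t).
Proof.
by move=> s t /(congr1 val)/(inj_map (@perm_inj _ (wext B f)))/val_inj.
Qed.

Definition tuple_ext f : {perm n.-tuple B} := perm (@tuple_ext_inj f).

Lemma tuple_extE f t : tuple_ext f t = map (wext B f) t :> seq B.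
Proof. by rewrite permE. Qed.

Lemma tuple_extM f g : prange f = pdom g ->
  tuple_ext (pauto_comp g f) = (tuple_ext f * tuple_ext g)%g.
Proof.
move=> fg; apply/permP=> t; apply: val_inj.
rewrite permM /= !tuple_extE -map_comp.
by apply: eq_map => x; rewrite wextM // permM.
Qed.

Lemma mem_tuple_ext f t x : (wext B f x \in tuple_ext f t) = (x \in t).
Proof. by rewrite memtE tuple_extE (mem_map perm_inj). Qed.

Lemma closing_ext f t x y :
  closing (tuple_ext f t) (wext B f x) (wext B f y) = closing t x y.
Proof. by rewrite /closing !tuple_extE !(index_map perm_inj). Qed.

Lemma bad_cycle_ext f t : bad_cycle good (tuple_ext f t) = bad_cycle good t.
Proof.
rewrite tuple_extE; apply/idP/idP => [bad_ft|]; last first.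
  by apply: map_bad_cycle => u v _; apply: label_ext.
rewrite -[tval t](mapK (permK (wext B f))).
apply: map_bad_cycle bad_ft => u v _.
by rewrite -{2}(permKV (wext B f) u) -{2}(permKV (wext B f) v) label_ext.
Qed.

Definition cycle_shift f t : bool := bad_cycle good t &&
  [exists a, exists b, [&& f a == Some b, wemb B a \in t
                         & cycle_chi a t (+) cycle_chi b (tuple_ext f t)]].

Lemma cycle_shiftE f t a b :
  bad_cycle good t -> f a = Some b -> wemb B a \in t ->
  cycle_shift f t = cycle_chi a t (+) cycle_chi b (tuple_ext f t).
Proof.
move=> bad_t fab a_t; rewrite /cycle_shift bad_t /=.
apply/existsP/idP => [[c /existsP[d /and3P[/eqP fcd c_t]]]|shift_a]; last first.
  by exists a; apply/existsP; exists b; rewrite fab a_t shift_a eqxx.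
have [eq_ac|ac] := eqVneq a c; first by move: fcd; rewrite -eq_ac fab => -[->].
have bd : b != d.
  by apply: contraNneq ac => bd; apply/eqP/(pauto_inj fab); rewrite bd.
have b_ft : wemb B b \in tuple_ext f t.
  by rewrite -(wext_emb B fab) mem_tuple_ext.
have d_ft : wemb B d \in tuple_ext f t.
  by rewrite -(wext_emb B fcd) mem_tuple_ext.
have bad_ft : bad_cycle good (tuple_ext f t) by rewrite bad_cycle_ext.
have := cycle_chiD bad_t a_t c_t ac; have := cycle_chiD bad_ft b_ft d_ft bd.
rewrite -(wext_emb B fab) -(wext_emb B fcd) closing_ext => <-.
by do 4!case: (cycle_chi _ _).
Qed.

Lemma cycle_shift_out f t : (forall a b, f a = Some b -> wemb B a \notin t) ->
  cycle_shift f t = false.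
Proof.
move=> out; apply/negP=> /andP[_ /existsP[a /existsP[b /and3P[/eqP fab]]]].
by rewrite (negPf (out _ _ fab)).
Qed.

Lemma cycle_shift_comp f g t : prange f = pdom g ->
  cycle_shift (pauto_comp g f) t =
  cycle_shift f t (+) cycle_shift g (tuple_ext f t).
Proof.
move=> fg; have [bad_t|good_t] := boolP (bad_cycle good t); last first.
  by rewrite /cycle_shift bad_cycle_ext // (negPf good_t).
have [/existsP[a /andP[/pdomP[b fab] a_t]]|/existsPn out] :=
    boolP [exists a, (a \in pdom f) && (wemb B a \in t)].
  have /pdomP[c gbc] : b \in pdom g by rewrite -fg (mem_prange fab).
  have gfac : pauto_comp g f a = Some c by apply/pcompP; exists b.
  have b_t : wemb B b \in tuple_ext f t.
    by rewrite -(wext_emb B fab) mem_tuple_ext.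
  rewrite (cycle_shiftE bad_t gfac a_t) (cycle_shiftE bad_t fab a_t).
  rewrite (cycle_shiftE _ gbc b_t) ?bad_cycle_ext // tuple_extM // permM.
  by rewrite addbA -[X in _ = X (+) _]addbA addbb addbF.
have out_f a b : f a = Some b -> wemb B a \notin t.
  by move=> fab; have := out a; rewrite (mem_pdom fab).
rewrite !cycle_shift_out // => [b c gbc|a c].
  have /prangeP[a fab] : b \in prange f by rewrite fg (mem_pdom gbc).
  by rewrite -(wext_emb B fab) mem_tuple_ext; apply: out_f fab.
by case/pcompP=> b /out_f.
Qed.

Definition cycle_twist f x t : {perm bool} :=
  perm (@addIb ((x \in t) && cycle_shift f t)).

Lemma cycle_twistE f x t w :
  cycle_twist f x t w = w (+) ((x \in t) && cycle_shift f t).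
Proof. by rewrite permE. Qed.

Lemma cycle_chi_out a t : wemb B a \notin t -> cycle_chi a t = false.
Proof.
move=> a_t; rewrite /cycle_chi; case: eqP => [idx|]; rewrite ?andbF //.
by rewrite -index_tuple_lt idx in a_t; lia.
Qed.

Lemma cycle_valuation :
  valuation (wemb B) (wext B) tuple_ext cycle_twist cycle_chi.
Proof.
split=> [f g|f a b t fab|f g x t fg]; first exact: tuple_extM.
  rewrite cycle_twistE; have [a_t|a_t] := boolP (wemb B a \in t); last first.
    by rewrite addbF !cycle_chi_out // -(wext_emb B fab) mem_tuple_ext.
  have [bad_t|good_t] := boolP (bad_cycle good t).
    by rewrite (cycle_shiftE bad_t fab a_t) addKb.
  by rewrite /cycle_shift /cycle_chi bad_cycle_ext (negPf good_t).
apply/permP=> w; rewrite permM !cycle_twistE mem_tuple_ext cycle_shift_comp //.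
by case: (x \in t); rewrite ?addbF //= addbA.
Qed.

Definition cycle_compat t : rel (B * bool) := fun u v =>
  [&& bad_cycle good t, u.1 \in t & v.1 \in t] ==>
  (u.2 (+) v.2 == closing t u.1 v.1).

Lemma cycle_compatibility :
  compatibility tuple_ext cycle_twist cycle_chi cycle_compat.
Proof.
split=> [t u v|f t x y w z|t a b ab].
- by rewrite /cycle_compat addbC closingC (andbC (u.1 \in t)).
- rewrite /cycle_compat /= !cycle_twistE bad_cycle_ext closing_ext.
  rewrite !mem_tuple_ext; case: (x \in t); case: (y \in t); rewrite ?andbF //=.
  by rewrite addbACA addbb addbF.
by apply/implyP=> /and3P[bad_t a_t b_t]; rewrite /= cycle_chiD.
Qed.

Definition cycle_witness : witness A delta :=
  lift_witness cycle_valuation cycle_compatibility.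

Lemma fst_label_preserving :
  edge_label_preserving (fst : cycle_witness -> B).
Proof. by move=> u v /adj_lift[]. Qed.

Lemma closing_nth x0 t i j : uniq t -> i < n -> j < n ->
  closing t (nth x0 t i) (nth x0 t j) =
  (i == 0) && (j == n.-1) || (i == n.-1) && (j == 0).
Proof.
by move=> uniq_t i_lt j_lt; rewrite /closing !index_uniq ?size_tuple.
Qed.

Lemma bad_cycle_no_lift (s : seq cycle_witness) t : cycle adj s ->
  map fst s = t -> ~~ bad_cycle good t.
Proof.
move=> cyc_s st; apply/negP=> bad_t.
have uniq_t := bad_cycle_uniq goodP good_lt bad_t (size_tuple t).
have size_s : size s = n by rewrite -(size_map fst) st size_tuple.
have u0 : cycle_witness by move: n_gt3; rewrite -size_s; case: (s).
pose c i := (nth u0 s i).2 t.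
have fst_nth i : i < n -> (nth u0 s i).1 = nth u0.1 t i.
  by move=> i_lt; rewrite -st (nth_map u0) ?size_s.
have c_step i j : i < n -> j < n -> adj (nth u0 s i) (nth u0 s j) ->
    c i (+) c j = (i == 0) && (j == n.-1) || (i == n.-1) && (j == 0).
  move=> i_lt j_lt /adj_lift[_ /(_ t)]; rewrite /cycle_compat bad_t /=.
  by rewrite !fst_nth // !mem_nth ?size_tuple // closing_nth // => /eqP.
have c_const i : i < n -> c i = c 0.
  elim: i => // i IHi i_lt; have i_lt' := ltnW i_lt.
  have := cycle_nth u0 cyc_s (i := i); rewrite size_s => /(_ i_lt)/c_step.
  have -> : (i == 0) && (i.+1 == n.-1) || (i == n.-1) && (i.+1 == 0) = false.
    by lia.
  by rewrite -(IHi i_lt') => /(_ i_lt' i_lt); do 2!case: (c _).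
have [last_lt pos_n] : n.-1 < n /\ 0 < n by lia.
have := cycle_last_head u0 cyc_s; rewrite size_s => /(_ pos_n)/c_step.
by move/(_ last_lt pos_n); rewrite c_const // addbb !eqxx orbT.
Qed.

Lemma cycle_witness_good (s : seq cycle_witness) :
  cycle adj s -> size s < n.+1 -> good (cyc_labels s).
Proof.
move=> cyc_s size_s; apply: contraT => bad_s.
have /andP[cyc_t bad_t] : bad_cycle good (map fst s).
  by apply: (map_bad_cycle fst_label_preserving); apply/andP.
have [lt_n|n_le] := ltnP (size s) n.
  by move: bad_t; rewrite good_lt ?size_map.
have size_t : size (map fst s) == n by rewrite size_map eqn_leq n_le andbT.
have := @bad_cycle_no_lift s (Tuple size_t) cyc_s erefl.
by rewrite /bad_cycle /= cyc_t bad_t.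
Qed.

End CycleStep.

Lemma good_short_cycles (A : finMetricSpace) (delta : nat)
    (good : pred (seq nat)) (B : witness A delta) :
  word_class delta good -> faithful_cliques B ->
  (forall x y z : A, x != y -> y != z -> z != x ->
     good [:: fdist x y; fdist y z; fdist z x]) ->
  forall t : seq B, cycle adj t -> size t < 4 -> good (cyc_labels t).
Proof.
move=> goodP faithful good_tri [|x [|y [|z [|w t]]]] //=.
- by move=> _ _; apply: good_nil goodP.
- by rewrite adjxx.
- by move=> _ _; rewrite (labelC y x); apply: good_pair goodP _.
case/and4P=> xy yz zx _ _; have cl : clique [set x; y; z].
  by move=> u v; rewrite !inE => /orP[/orP[]|] /eqP-> /orP[/orP[]|] /eqP-> //;
    rewrite ?eqxx // adjC.
have /embeddableP[j jP] := faithful _ cl.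
have j_edge u v : u \in [set x; y; z] -> v \in [set x; y; z] -> adj u v ->
    (fdist (j u) (j v) = label u v) * (j u != j v).
  by move=> uS vS uv; rewrite -fdist_gt0 jP // (adj_neq uv).
have [jxy jyz jzx] : [/\ (fdist (j x) (j y) = label x y) * (j x != j y),
    (fdist (j y) (j z) = label y z) * (j y != j z)
    & (fdist (j z) (j x) = label z x) * (j z != j x)]%type.
  by split; apply: j_edge; rewrite // !inE eqxx ?orbT.
by rewrite -jxy -jyz -jzx; apply: good_tri; rewrite ?jxy ?jyz ?jzx.
Qed.

(* Cliques are made faithful first, so that closed walks of length 3 are
   copies of triangles of [A]; longer bad walks are then removed by length. *)
Theorem unwinding (A : finMetricSpace) (delta : nat) (good : pred (seq nat)) :
  word_class delta good -> (forall a b : A, fdist a b <= delta) ->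
  (forall x y z : A, x != y -> y != z -> z != x ->
     good [:: fdist x y; fdist y z; fdist z x]) ->
  exists B : witness A delta, faithful_cliques B /\ good_graph B good.
Proof.
move=> goodP dist_le good_tri; have [N goodN] := good_long goodP.
have [B [faithfulB good_lt]] : exists B : witness A delta, faithful_cliques B /\
    forall t : seq B, cycle adj t -> size t < N.+4 -> good (cyc_labels t).
  elim: N {goodN} => [|N [B [faithfulB good_lt]]].
    pose j0 : base_witness dist_le -> A := fst.
    have faithfulB := @clique_witness_faithful _ _ _ j0.
    by exists (clique_witness j0); split=> //; apply: good_short_cycles.
  exists (cycle_witness goodP (isT : 3 < N.+4) good_lt); split.
    exact: lift_faithful_cliques.
  exact: cycle_witness_good.
exists B; split=> // t cyc_t; have [|size_t] := ltnP (size t) N.+4.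
  exact: good_lt.
by apply: goodN; [apply: cyc_labels_in | rewrite size_cyc_labels; lia].
Qed.

(** * Marked words and walks *)

(* [s] consists of the marked letters of [w], which stand for the long sides of
   a cycle. *)
Definition marking (w : seq nat) (k x r : nat) : Prop :=
  exists s : seq nat, [/\ subseq s w, size s = k, sumn s = x & sumn w = x + r].

Lemma subseq_sumn_map f s w : subseq s w -> all (fun a => f a <= a) w ->
  sumn (map f w) + sumn s <= sumn (map f s) + sumn w.
Proof.
elim: w s => [|b w IHw] [|a s] //= sub_s /andP[fb le_f].
  by have := IHw [::] (sub0seq w) le_f; rewrite /=; lia.
by move: sub_s; case: eqP => [<-|_] sub_s; have := IHw _ sub_s le_f => /=; lia.
Qed.

Lemma sumn_map_const c (s : seq nat) : sumn (map (fun=> c) s) = size s * c.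
Proof. by elim: s => //= a s ->. Qed.

Lemma subseq_sumn s w : subseq s w -> sumn s <= sumn w.
Proof.
move=> sub; have := subseq_sumn_map (f := fun=> 0) sub (all_predT _).
by rewrite !sumn_map_const !muln0.
Qed.

Lemma sumn_le_size m (s : seq nat) : all (fun a => a <= m) s ->
  sumn s <= size s * m.
Proof. by elim: s => //= a s IHs /andP[am /IHs]; rewrite mulSn; lia. Qed.

Lemma marking0 w : marking w 0 0 (sumn w).
Proof. by exists [::]; rewrite sub0seq. Qed.

Lemma marking_letter a : marking [:: a] 1 a 0.
Proof. by exists [:: a]; rewrite /= eqxx addn0. Qed.

Lemma marking_cat w1 w2 k1 x1 r1 k2 x2 r2 :
  marking w1 k1 x1 r1 -> marking w2 k2 x2 r2 ->
  marking (w1 ++ w2) (k1 + k2) (x1 + x2) (r1 + r2).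
Proof.
move=> [s1 [sub1 <- <- sum1]] [s2 [sub2 <- <- sum2]]; exists (s1 ++ s2).
by rewrite cat_subseq // size_cat !sumn_cat sum1 sum2 addnACA.
Qed.

Lemma marking_catP w1 w2 k x r : marking (w1 ++ w2) k x r ->
  exists k1 x1 r1 k2 x2 r2, [/\ marking w1 k1 x1 r1, marking w2 k2 x2 r2,
    k = k1 + k2, x = x1 + x2 & r = r1 + r2].
Proof.
case=> s [/subseqP[m sz_m ->]]; set s1 := mask (take (size w1) m) w1.
set s2 := mask (drop (size w1) m) w2; have -> : mask m (w1 ++ w2) = s1 ++ s2.
  rewrite -{1}(cat_take_drop (size w1) m) mask_cat //.
  by rewrite size_takel // sz_m size_cat leq_addr.
have [sub1 sub2] : subseq s1 w1 /\ subseq s2 w2 by split; apply: mask_subseq.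
have := subseq_sumn sub1; have := subseq_sumn sub2.
rewrite size_cat !sumn_cat => le2 le1 <- <- sum_w.
exists (size s1), (sumn s1), (sumn w1 - sumn s1).
exists (size s2), (sumn s2), (sumn w2 - sumn s2).
by split=> //; [exists s1 | exists s2 | ]; try split=> //; lia.
Qed.

Lemma marking_rev w k x r : marking w k x r -> marking (rev w) k x r.
Proof.
case=> s [sub <- <- sum_w]; exists (rev s).
by rewrite subseq_rev size_rev !sumn_rev.
Qed.

Lemma marking_sum w k x r : marking w k x r -> sumn w = x + r.
Proof. by case=> s []. Qed.

Section MarkingBounds.

Variables (delta : nat) (w : seq nat) (k x r : nat).
Hypotheses (w_in : labels_in delta w) (mw : marking w k x r).

Lemma marking_le : x <= k * delta.
Proof.
have [s [/mem_subseq sub <- <- _]] := mw; apply: sumn_le_size.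
by apply/allP=> a /sub/(allP w_in)/andP[].
Qed.

Lemma marking_size : size w <= k + r.
Proof.
have [s [sub <- <- sum_w]] := mw.
have pos_w : all (fun a => 0 < a) w by apply: sub_all w_in => a /andP[].
have := subseq_sumn_map (f := fun=> 1) sub pos_w.
by rewrite !sumn_map_const !muln1 sum_w; lia.
Qed.

Lemma marking_cost E : 2 * delta + 2 <= E ->
  2 * size w + 2 * x <= 2 * r + k * E.
Proof.
move=> E_ge; have := leq_mul (leqnn k) E_ge; rewrite mulnDr mulnCA.
by have := marking_le; have := marking_size; lia.
Qed.

End MarkingBounds.

Section MarkedWalks.

Variables (delta : nat) (G : lgraph delta).
Implicit Types u v w : G.

Definition marked_walk u v (k x r : nat) : Prop :=
  exists p, [/\ path adj u p, last u p = v & marking (pairmap label u p) k x r].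

Lemma marked_walk_cat v u w k1 x1 r1 k2 x2 r2 :
  marked_walk u v k1 x1 r1 -> marked_walk v w k2 x2 r2 ->
  marked_walk u w (k1 + k2) (x1 + x2) (r1 + r2).
Proof.
case=> p [up <- mp] [q [vq <- mq]]; exists (p ++ q).
by rewrite cat_path up last_cat pairmap_cat; split=> //; apply: marking_cat.
Qed.

Lemma marked_walk_cat3 u v w z k1 x1 r1 k2 x2 r2 k3 x3 r3 :
  marked_walk u v k1 x1 r1 -> marked_walk v w k2 x2 r2 ->
  marked_walk w z k3 x3 r3 ->
  marked_walk u z (k1 + k2 + k3) (x1 + x2 + x3) (r1 + r2 + r3).
Proof.
by move=> walk1 walk2; apply/marked_walk_cat/(marked_walk_cat walk1).
Qed.

Lemma marked_walk_off u v : adj u v -> marked_walk u v 0 0 (label u v).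
Proof.
move=> uv; exists [:: v]; rewrite /= uv; split=> //.
by rewrite -[X in marking _ _ _ X]addn0; apply: (marking0 [:: _]).
Qed.

Lemma marked_walk_on u v : adj u v -> marked_walk u v 1 (label u v) 0.
Proof.
by move=> uv; exists [:: v]; rewrite /= uv; split=> //; apply: marking_letter.
Qed.

Lemma pairmap_label_rev u p :
  pairmap label (last u p) (rev (belast u p)) = rev (pairmap label u p).
Proof.
elim: p u => //= v p IHp u.
rewrite rev_cons -cats1 pairmap_cat IHp rev_cons -cats1.
congr (_ ++ _); rewrite /= labelC; congr [:: label _ _].
by case: p {IHp} => //= w p; rewrite rev_cons last_rcons.
Qed.

Lemma marked_walk_rev u v k x r :
  marked_walk u v k x r -> marked_walk v u k x r.
Proof.
case=> p [up <- mp]; exists (rev (belast u p)); split.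
- by rewrite rev_path; apply: sub_path up => w z; rewrite adjC.
- by case: p {up mp} => //= w p; rewrite rev_cons last_rcons.
by rewrite pairmap_label_rev; apply: marking_rev.
Qed.

Lemma marked_walk_le u v k x r : marked_walk u v k x r -> x <= k * delta.
Proof. by case=> p [up _]; apply: marking_le; apply: path_labels. Qed.

Definition min_steps u v : nat :=
  if u == v then 0 else if adj u v then 1 else 2.

Lemma path_steps u p : path adj u p -> min_steps u (last u p) <= size p.
Proof.
rewrite /min_steps; case: p => [|v [|w p]] /=; first by rewrite eqxx.
  by rewrite andbT => ->; case: eqP.
by case: ifP => // _; case: ifP.
Qed.

Lemma marked_walk_steps u v k x r : marked_walk u v k x r ->
  min_steps u v <= k + r.
Proof.
case=> p [up <- mp]; have := path_steps up.
by have := marking_size (path_labels up) mp; rewrite size_pairmap; lia.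
Qed.

Lemma marked_walk_cost E u v k x r : 2 * delta + 2 <= E ->
  marked_walk u v k x r -> 2 * min_steps u v + 2 * x <= 2 * r + k * E.
Proof.
move=> E_ge [p [up <- mp]]; have := path_steps up.
by have := marking_cost (path_labels up) mp E_ge; rewrite size_pairmap; lia.
Qed.

Lemma marked_walk_closed good u k x r :
  word_class delta good -> good_graph G good -> marked_walk u u k x r ->
  exists w : seq nat, [/\ labels_in delta w, good w & marking w k x r].
Proof.
move=> goodP goodG [p [up + mp]]; case/lastP: p => [|p v] in up mp *.
  by exists [::]; split=> //; apply: good_nil goodP.
rewrite last_rcons => eq_vu; rewrite eq_vu in up mp.
exists (cyc_labels (u :: p)); split=> //; last exact: goodG.
exact: path_labels.
Qed.

Lemma marked_walkC u v : marked_walk u v = marked_walk v u.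
Proof.
by do 3!apply/funext=> ?; apply/propext; split; apply: marked_walk_rev.
Qed.

Definition label_automorphism (s : {perm G}) : Prop :=
  forall u v, label (s u) (s v) = label u v.

Lemma marked_walk_map (s : {perm G}) u v k x r : label_automorphism s ->
  marked_walk u v k x r -> marked_walk (s u) (s v) k x r.
Proof.
move=> sP [p [up <- mp]]; exists (map s p); rewrite last_map.
by have [path_sp ->] := map_walk (fun u' v' _ => sP u' v') up.
Qed.

Lemma marked_walk_aut (s : {perm G}) u v : label_automorphism s ->
  marked_walk (s u) (s v) = marked_walk u v.
Proof.
move=> sP; have sVP : label_automorphism s^-1%g.
  by move=> u' v'; rewrite -sP !permKV.
do 3!apply/funext=> ?; apply/propext; split; last exact: marked_walk_map.
by move/(marked_walk_map sVP); rewrite !permK.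
Qed.

End MarkedWalks.

(** * Clamped completion *)

Record clamped (Up Lo : nat -> Prop) (m t : nat) : Prop := Clamped {
  clamped_le : forall s, Up s -> t <= s;
  clamped_ge : forall s, Lo s -> s <= t;
  clamped_upper : t < m -> Up t;
  clamped_lower : m < t -> Lo t
}.

Lemma clamped_exists (Up Lo : nat -> Prop) (m bound : nat) :
  (forall s t, Lo s -> Up t -> s <= t) -> (forall s, Lo s -> s <= bound) ->
  exists t, clamped Up Lo m t.
Proof.
move=> Lo_le_Up Lo_le; have [[s [Us sm]]|no_Up] := EM (exists s, Up s /\ s < m).
  have ex_Up : exists s, `[< Up s >] by exists s; apply/asboolP.
  case: (ex_minnP ex_Up) => t /asboolP Ut t_min; exists t.
  have := t_min s (asboolT Us); split=> //; last by lia.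
    by move=> z /asboolP; apply: t_min.
  by move=> z Lz; apply: Lo_le_Up Ut.
have [[s [Ls sm]]|no_Lo] := EM (exists s, Lo s /\ m < s).
  have ex_Lo : exists s, `[< Lo s >] by exists s; apply/asboolP.
  have Lo_bounded z : `[< Lo z >] -> z <= bound by move/asboolP/Lo_le.
  case: (ex_maxnP ex_Lo Lo_bounded) => t /asboolP Lt t_max; exists t.
  have := t_max s (asboolT Ls); split=> //; last by lia.
    by move=> z Uz; apply: Lo_le_Up Uz.
  by move=> z /asboolP; apply: t_max.
exists m; split=> [s Us|s Ls||]; rewrite ?ltnn // leqNgt; apply/negP => sm.
  by apply: no_Up; exists s.
by apply: no_Lo; exists s.
Qed.

Definition clamp (Up Lo : nat -> Prop) (m : nat) : nat :=
  if pselect (exists t, clamped Up Lo m t) is left ex then sval (cid ex) else m.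

Lemma clampP (Up Lo : nat -> Prop) (m : nat) :
  (exists t, clamped Up Lo m t) -> clamped Up Lo m (clamp Up Lo m).
Proof. by rewrite /clamp; case: pselect => // ex _; apply: svalP. Qed.

Section Bounds.

Variables (delta E : nat) (G : lgraph delta).
Implicit Types u v w : G.

(* Walking along a marked edge replaces its length [a] by [E/2 - a] and passes
   to the antipode in a formal double cover where antipodes are at distance
   [E/2]; [upper] and [lower] are the bounds given by shortest paths there. *)
Definition upper u v t : Prop := exists h x r,
  marked_walk u v h.*2 x r /\ t + x = r + h * E.
Definition lower u v t : Prop := exists h x r,
  marked_walk u v h.*2.+1 x r /\ t + r + h * E = x.

Lemma upperC u v : upper u v = upper v u.
Proof. by rewrite /upper marked_walkC. Qed.

Lemma lowerC u v : lower u v = lower v u.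
Proof. by rewrite /lower marked_walkC. Qed.

Lemma upper_aut (s : {perm G}) u v : label_automorphism s ->
  upper (s u) (s v) = upper u v.
Proof. by move=> sP; rewrite /upper marked_walk_aut. Qed.

Lemma lower_aut (s : {perm G}) u v : label_automorphism s ->
  lower (s u) (s v) = lower u v.
Proof. by move=> sP; rewrite /lower marked_walk_aut. Qed.

Lemma upper_edge u v : adj u v -> upper u v (label u v).
Proof.
by move=> uv; exists 0, 0, (label u v); split=> //; apply: marked_walk_off.
Qed.

Lemma lower_edge u v : adj u v -> lower u v (label u v).
Proof.
by move=> uv; exists 0, (label u v), 0; split; [apply: marked_walk_on | lia].
Qed.

Lemma upper_upper v u w s t : upper u v s -> upper v w t -> upper u w (s + t).
Proof.
case=> h1 [x1 [r1 [walk1 eq_s]]] [h2 [x2 [r2 [walk2 eq_t]]]].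
exists (h1 + h2), (x1 + x2), (r1 + r2); rewrite doubleD mulnDl.
by split; [apply: marked_walk_cat walk2 | lia].
Qed.

Lemma lower_upper v u w s t : lower u v s -> upper v w t -> t <= s ->
  lower u w (s - t).
Proof.
case=> h1 [x1 [r1 [walk1 eq_s]]] [h2 [x2 [r2 [walk2 eq_t]]]] ts.
exists (h1 + h2), (x1 + x2), (r1 + r2); rewrite doubleD mulnDl -addSn.
by split; [apply: marked_walk_cat walk2 | lia].
Qed.

Lemma lower_lower v u w s t : lower u v s -> lower v w t -> s + t <= E ->
  upper u w (E - s - t).
Proof.
case=> h1 [x1 [r1 [walk1 eq_s]]] [h2 [x2 [r2 [walk2 eq_t]]]] st.
exists (h1 + h2).+1, (x1 + x2), (r1 + r2).
rewrite mulSn mulnDl; split; last by lia.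
have -> : (h1 + h2).+1.*2 = h1.*2.+1 + h2.*2.+1 by lia.
exact: marked_walk_cat walk2.
Qed.

Hypothesis E_ge : 2 * delta + 2 <= E.

Lemma double_marks_le h x : x <= h.*2 * delta -> x <= h * E.
Proof.
move=> x_le; apply: leq_trans x_le _.
by rewrite -muln2 -mulnA leq_mul2l (leq_trans _ E_ge) ?orbT ?leq_addr.
Qed.

Lemma upper_plain u v t : upper u v t ->
  marked_walk u v 0 0 t \/ E <= t + 2 * delta.
Proof.
case=> -[|h] [x [r [walk eq_t]]]; have x_le := marked_walk_le walk.
  have [x0 eq_tr] : x = 0 /\ t = r by lia.
  by left; rewrite eq_tr -{2}x0.
right; have := @double_marks_le h (x - 2 * delta).
by rewrite doubleS !mulSn in x_le eq_t *; lia.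
Qed.

Lemma lower_plain u v t : lower u v t ->
  (exists x r, marked_walk u v 1 x r /\ t + r = x) \/ t + E <= 3 * delta.
Proof.
case=> -[|h] [x [r [walk eq_t]]]; have x_le := marked_walk_le walk.
  by left; exists x, r; split=> //; lia.
right; have := @double_marks_le h (x - 3 * delta).
by rewrite doubleS !mulSn in x_le eq_t *; lia.
Qed.

Lemma lower_le u v t : lower u v t -> t <= delta.
Proof.
by case/lower_plain=> [[x [r [/marked_walk_le]]]|]; lia.
Qed.

Lemma min_steps_le_upper u v t : upper u v t -> min_steps u v <= t.
Proof.
by case=> h [x [r [/(marked_walk_cost E_ge)]]]; rewrite -muln2 -mulnA; lia.
Qed.

Lemma lower_min_steps u v t : lower u v t -> t + min_steps u v <= delta.+1.
Proof.
case/lower_plain=> [[x [r [walk eq_t]]]|]; last first.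
  by rewrite /min_steps; case: ifP => _; [ | case: ifP => _]; lia.
by have := marked_walk_steps walk; have := marked_walk_le walk; lia.
Qed.

End Bounds.

(* The case [k = 1] is the polygon inequality for the longest side of a cycle;
   for larger [k] it says that distances in the double cover are consistent. *)
Definition odd_marks_bound (E k x r : nat) : Prop :=
  odd k -> E + 2 * x <= 2 * r + k * E.

Record completable (delta E : nat) (G : lgraph delta)
    (centre : G -> G -> nat) : Prop := Completable {
  completable_E : 2 * delta + 2 <= E;
  completable_closed : forall (u : G) k x r,
    marked_walk u u k x r -> odd_marks_bound E k x r;
  centreC : forall u v, centre u v = centre v u;
  centre_aut : forall s : {perm G}, label_automorphism s ->
    forall u v, centre (s u) (s v) = centre u v;
  centre_near : forall u v x y, centre u v <= (centre x y).+1;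
  centre_range : forall u v, 1 < centre u v < delta;
  delta_le_centre : forall u v, delta <= 2 * centre u v;
  centre_le_E : forall u v, 2 * centre u v + delta <= E
}.

Section Completion.

Variables (delta E : nat) (G : lgraph delta) (centre : G -> G -> nat).
Hypothesis completableP : completable E centre.
Implicit Types u v x y z : G.

Definition completion u v : nat :=
  if u == v then 0 else clamp (upper E u v) (lower E u v) (centre u v).

Lemma lower_le_upper u v s t : lower E u v s -> upper E u v t -> s <= t.
Proof.
rewrite upperC => -[h1 [x1 [r1 [walk1 eq_s]]]] [h2 [x2 [r2 [walk2 eq_t]]]].
have := completable_closed completableP (marked_walk_cat walk1 walk2).
rewrite /odd_marks_bound addSn -doubleD /= odd_double mulSn -muln2 !mulnDl.
by lia.
Qed.

Lemma completionP u v : u != v ->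
  clamped (upper E u v) (lower E u v) (centre u v) (completion u v).
Proof.
rewrite /completion => /negPf->; apply: clampP.
apply: (@clamped_exists _ _ _ delta) => [s t|s]; first exact: lower_le_upper.
exact: (lower_le (completable_E completableP)).
Qed.

Lemma completion_lt_centre u v : u != v -> completion u v < centre u v ->
  min_steps u v <= completion u v.
Proof.
move=> /completionP uvP /(clamped_upper uvP).
exact: (min_steps_le_upper (completable_E completableP)).
Qed.

Lemma centre_lt_completion u v : u != v -> centre u v < completion u v ->
  completion u v + min_steps u v <= delta.+1.
Proof.
move=> /completionP uvP /(clamped_lower uvP).
exact: (lower_min_steps (completable_E completableP)).
Qed.

Lemma completionxx u : completion u u = 0.
Proof. by rewrite /completion eqxx. Qed.

Lemma completionC u v : completion u v = completion v u.
Proof. by rewrite /completion eq_sym upperC lowerC (centreC completableP). Qed.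

Lemma completion_aut (s : {perm G}) u v : label_automorphism s ->
  completion (s u) (s v) = completion u v.
Proof.
move=> sP; rewrite /completion (inj_eq perm_inj) upper_aut // lower_aut //.
by rewrite (centre_aut completableP sP).
Qed.

Lemma completion_edge u v : adj u v -> completion u v = label u v.
Proof.
move=> uv; have dP := completionP (adj_neq uv); apply/eqP; rewrite eqn_leq.
by rewrite (clamped_le dP (upper_edge _ uv)) (clamped_ge dP (lower_edge _ uv)).
Qed.

Lemma completion_gt0 u v : u != v -> 0 < completion u v.
Proof.
move=> uv; have := centre_range completableP u v.
have := completion_lt_centre uv; rewrite /min_steps (negPf uv).
by case: ifP; lia.
Qed.

Lemma completion_le u v : u != v -> completion u v <= delta.
Proof.
move=> uv; have := centre_range completableP u v.
have := centre_lt_completion uv; rewrite /min_steps (negPf uv).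
by case: ifP; lia.
Qed.

Lemma completion_nonedge u v : u != v -> ~~ adj u v ->
  1 < completion u v < delta.
Proof.
move=> uv nadj; have := centre_range completableP u v.
have := completion_lt_centre uv; have := centre_lt_completion uv.
by rewrite /min_steps (negPf uv) (negPf nadj); lia.
Qed.

Lemma completion_triangle_lt x y z : x != y -> y != z -> x != z ->
  completion x y < centre x y ->
  completion x z <= completion x y + completion y z.
Proof.
move=> xy yz xz lt_xy; have gt0_xy := completion_gt0 xy.
have up_xy := clamped_upper (completionP xy) lt_xy.
have [lt_yz|ge_yz] := ltnP (completion y z) (centre y z).
  have up_yz := clamped_upper (completionP yz) lt_yz.
  exact: (clamped_le (completionP xz) (upper_upper up_xy up_yz)).
rewrite leqNgt; apply/negP=> gt_xz.
have near_c := centre_near completableP x z y z.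
have /(clamped_lower (completionP xz)) : centre x z < completion x z by lia.
rewrite lowerC => /lower_upper/(_ up_xy); rewrite lowerC => low_yz.
by have := clamped_ge (completionP yz) (low_yz _); lia.
Qed.

Lemma completion_triangle x y z :
  completion x z <= completion x y + completion y z.
Proof.
have [->|xy] := eqVneq x y; first by rewrite completionxx.
have [->|yz] := eqVneq y z; first by rewrite completionxx addn0.
have [->|xz] := eqVneq x z; first by rewrite completionxx.
have [lt_xy|ge_xy] := ltnP (completion x y) (centre x y).
  exact: completion_triangle_lt.
have [lt_yz|ge_yz] := ltnP (completion y z) (centre y z).
  rewrite addnC completionC (completionC x y) (completionC y z).
  apply: completion_triangle_lt; rewrite 1?eq_sym //.
  by rewrite completionC (centreC completableP).
have := completion_le xz; have := delta_le_centre completableP x y.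
by have := delta_le_centre completableP y z; lia.
Qed.

Lemma completion_triangles x y z :
  [/\ completion x z <= completion x y + completion y z,
      completion y z <= completion x y + completion x z
    & completion x y <= completion x z + completion y z].
Proof.
split; first exact: completion_triangle.
  by rewrite (completionC x y) completion_triangle.
by rewrite (completionC y z) completion_triangle.
Qed.

Lemma completion_metric : is_metric completion.
Proof.
split=> [u v|u v|u v w].
- split=> [|->]; last exact: completionxx.
  by have [->|/completion_gt0] := eqVneq u v => //; lia.
- exact: completionC.
exact: completion_triangle.
Qed.

Lemma completion_perimeter_gt x y z : x != y -> y != z -> x != z ->
  centre x y < completion x y -> centre y z < completion y z ->
  completion x y + completion y z + completion x z <= E.
Proof.
move=> xy yz xz /(clamped_lower (completionP xy)) low_xy.
move=> /(clamped_lower (completionP yz)) low_yz.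
have E_ge := completable_E completableP.
have le_xy := completion_le xy; have le_yz := completion_le yz.
by have := clamped_le (completionP xz) (lower_lower low_xy low_yz _); lia.
Qed.

Lemma completion_perimeter x y z : x != y -> y != z -> x != z ->
  completion x y + completion y z + completion x z <= E.
Proof.
move=> xy yz xz; have [yx zy] : y != x /\ z != y by split; rewrite eq_sym.
have := completion_perimeter_gt yx xz yz.
have := completion_perimeter_gt xz zy xy.
rewrite (completionC y x) (completionC z y).
rewrite (centreC completableP y x) (centreC completableP z y).
have := completion_perimeter_gt xy yz xz.
have := completion_le xy; have := completion_le yz; have := completion_le xz.
have := centre_le_E completableP x y; have := centre_le_E completableP y z.
by have := centre_le_E completableP x z; lia.
Qed.

Definition completion_space : finMetricSpace :=
  FinMetricSpace completion_metric.

(* The distances [1] and [delta] occur only on edges, so [X] spans a clique. *)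
Lemma henson_subspace (A : finMetricSpace) (X : metricSpace) :
  (forall Q : {set G}, clique Q -> embeddable A Q) ->
  henson_constraint delta X -> embeds X completion_space -> embeds X A.
Proof.
move=> faithful hensonX [i iP].
have i_adj (x y : X) : i x != i y :> G -> adj (i x) (i y).
  move=> ixy; apply: contraT => /(completion_nonedge ixy).
  have xy : x <> y by move=> eq_xy; rewrite eq_xy eqxx in ixy.
  by have := iP x y; case: (hensonX x y xy) => -> /= ->; lia.
pose Q := [set v : G | `[< exists x : X, i x = v >]].
have mem_Q (x : X) : i x \in Q by rewrite inE; apply/asboolP; exists x.
have /faithful/embeddableP[j jP] : clique Q.
  by move=> u v; rewrite !inE => /asboolP[x <-] /asboolP[y <-]; apply: i_adj.
exists (j \o i) => x y; rewrite -iP /=; have [->|ixy] := eqVneq (i x : G) (i y).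
  by rewrite completionxx fdistxx.
by rewrite jP // completion_edge // i_adj.
Qed.

End Completion.

Definition total_ext (A : finMetricSpace) (delta : nat) (B : witness A delta)
    (f : {ffun A -> option A}) : B -> B :=
  if pselect (partial_automorphism f) is left fP then wext B (PAuto fP) else id.

Arguments total_ext {A delta} B f _.

Lemma total_extE (A : finMetricSpace) (delta : nat) (B : witness A delta)
    (f : {ffun A -> option A}) (fP : partial_automorphism f) :
  total_ext B f = wext B (PAuto fP).
Proof.
rewrite /total_ext; case: pselect => // fP'.
by have -> : PAuto fP' = PAuto fP by apply: eq_pauto.
Qed.

Lemma coherent_EPPA_completion delta E K1 K2 C0 C1 (S : metricSpace -> Prop)
    (good : pred (seq nat)) :
  word_class delta good ->
  (forall a b c, 1 <= a <= delta -> 1 <= b <= delta -> 1 <= c <= delta ->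
     a <= b + c -> b <= a + c -> c <= a + b ->
     triangle_allowed K1 K2 C0 C1 a b c -> good [:: a; b; c]) ->
  (forall G : lgraph delta, good_graph G good ->
     exists centre, completable E centre /\
       forall x y z : G, x != y -> y != z -> x != z ->
         triangle_allowed K1 K2 C0 C1 (completion E centre x y)
           (completion E centre y z) (completion E centre x z)) ->
  (forall X : metricSpace, S X -> henson_constraint delta X) ->
  coherent_EPPA (fun A => class_A delta K1 K2 C0 C1 A /\ class_AS S A).
Proof.
move=> goodP good_tri good_centre hensonS A [[distA triA] S_free].
have distA_le (a b : A) : fdist a b <= delta.
  by have [->|/eqP/distA/andP[]] := eqVneq a b; rewrite ?fdistxx.
have [|B [faithfulB goodB]] := unwinding goodP distA_le.
  move=> x y z xy yz zx; have [_ _ distT] := fdist_metric A.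
  have := distT x z y; have := distT y x z; have := distT z y x.
  rewrite (fdistC y x) (fdistC z y) (fdistC x z) => dist_xz dist_yz dist_zx.
  have := triA x y z (elimN eqP xy) (elimN eqP yz).
  rewrite /= [fdist x z]fdistC => tri.
  apply: good_tri; rewrite ?distA //; try lia; try exact/eqP.
  by apply: tri => eq_xz; rewrite eq_xz eqxx in zx.
have [centre [completableP allowed]] := good_centre B goodB.
exists (completion_space completableP); split; first split; first split.
- by move=> x y /eqP xy; rewrite /= completion_gt0 // completion_le.
- by move=> x y z /eqP xy /eqP yz /eqP xz; apply: allowed.
- move=> X SX embX; apply: (S_free X SX).
  exact: henson_subspace faithfulB (hensonS X SX) embX.
exists (wemb B); split.
  move=> a b /=; have [->|ab] := eqVneq a b.
    by rewrite completionxx fdistxx.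
  by rewrite completion_edge ?adj_emb // label_emb.
exists (total_ext B); split=> [f fP|f g h fP gP hP _ fg _ h_gf]; last first.
  have -> : total_ext B h = wext B (pauto_comp (PAuto gP) (PAuto fP)).
    rewrite (total_extE B hP); congr (fun_of_perm (wext B _)).
    exact: eq_pauto.
  by rewrite (total_extE B gP) (total_extE B fP) wextM // => u; rewrite permM.
rewrite (total_extE B fP); split; last by move=> a b fab; apply: wext_emb.
split=> [|u v]; last by apply: completion_aut => //; apply: label_ext.
by exists (wext B (PAuto fP))^-1%g; [apply: permK | apply: permKV].
Qed.

(** * Case (III) *)

Lemma marking_cons_off a w k x r : marking w k x r ->
  marking (a :: w) k x (a + r).
Proof.
by move=> mw; have := marking_cat (marking0 [:: a]) mw; rewrite /= addn0.
Qed.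

Lemma marking_cons_on a w k x r : marking w k x r ->
  marking (a :: w) k.+1 (a + x) r.
Proof. exact: marking_cat (marking_letter a). Qed.

Lemma marking_zeroE w k x r : marking (0 :: w) k x r ->
  marking w k x r \/ exists2 k', k = k'.+1 & marking w k' x r.
Proof.
rewrite -cat1s => /marking_catP[k1 [x1 [r1 [k2 [x2 [r2 []]]]]]].
case=> s [/size_subseq/= + <- <- /= /esym/eqP].
rewrite addn0 addn_eq0 => + /andP[/eqP-> /eqP->] mw -> -> ->.
by case: (size s) => [|[|]] // _; [left | right; exists k2].
Qed.

Definition marked_metric (E : nat) (w : seq nat) : Prop :=
  forall k x r, marking w k x r -> odd_marks_bound E k x r.

Definition odd_perimeter_bound (K1 : nat) (w : seq nat) : Prop :=
  odd (sumn w) -> 2 * K1 < sumn w.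

Definition two_marks_bound (K2 : nat) (w : seq nat) : Prop :=
  forall x r, marking w 2 x r -> odd (x + r) -> x < 2 * K2 + r.

Definition three_marks_bound (C : nat) (w : seq nat) : Prop :=
  forall x r, marking w 3 x r -> odd (x + r) = odd C -> x < C + r.

Lemma chord_le_sumn E c w : marked_metric E (c :: w) -> c <= sumn w.
Proof.
move=> /(_ _ _ _ (marking_cons_on c (marking0 w)))/(_ isT).
by rewrite addn0 mul1n; lia.
Qed.

Lemma marked_metric_glue E c w1 w2 : marked_metric E (c :: w1) ->
  marked_metric E (c :: w2) -> marked_metric E (w1 ++ w2).
Proof.
move=> metric1 metric2 k x r.
case/marking_catP=> k1 [x1 [r1 [k2 [x2 [r2 [mw1 mw2 -> -> ->]]]]]].
have := metric1 _ _ _ (marking_cons_off c mw1).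
have := metric1 _ _ _ (marking_cons_on c mw1).
have := metric2 _ _ _ (marking_cons_off c mw2).
have := metric2 _ _ _ (marking_cons_on c mw2).
rewrite /odd_marks_bound /= oddD !mulSn mulnDl.
by case: (odd k1); case: (odd k2) => /=; lia.
Qed.

Lemma odd_perimeter_glue E K1 c w1 w2 : marked_metric E (c :: w1) ->
  marked_metric E (c :: w2) -> odd_perimeter_bound K1 (c :: w1) ->
  odd_perimeter_bound K1 (c :: w2) -> odd_perimeter_bound K1 (w1 ++ w2).
Proof.
move=> /chord_le_sumn + /chord_le_sumn.
by rewrite /odd_perimeter_bound sumn_cat /=; lia.
Qed.

Section Gluing.

Variables (delta E K1 K2 C c : nat).
Hypothesis K_ge : 2 * delta <= K1 + 2 * K2 + 1.

Lemma two_marks_glue_unmarked w1 w2 x r :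
  marked_metric E (c :: w1) -> odd_perimeter_bound K1 (c :: w1) ->
  two_marks_bound K2 (c :: w2) -> marking w2 2 x r -> x <= 2 * delta ->
  odd (sumn w1 + x + r) -> x < 2 * K2 + sumn w1 + r.
Proof.
rewrite /odd_perimeter_bound /= => /chord_le_sumn c_le perimeter1 two2 mw x_le.
by have := two2 _ _ (marking_cons_off c mw); lia.
Qed.

Lemma two_marks_glue w1 w2 : labels_in delta w1 -> labels_in delta w2 ->
  marked_metric E (c :: w1) -> marked_metric E (c :: w2) ->
  odd_perimeter_bound K1 (c :: w1) -> odd_perimeter_bound K1 (c :: w2) ->
  two_marks_bound K2 (c :: w1) -> two_marks_bound K2 (c :: w2) ->
  two_marks_bound K2 (w1 ++ w2).
Proof.
move=> in1 in2 metric1 metric2 perimeter1 perimeter2 two1 two2 x r.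
case/marking_catP=> k1 [x1 [r1 [k2 [x2 [r2 [mw1 mw2 eq_k -> ->]]]]]] odd_w.
have x1_le := marking_le in1 mw1; have x2_le := marking_le in2 mw2.
have [sum1 sum2] := (marking_sum mw1, marking_sum mw2).
case: k1 k2 => [|[|[|k1]]] [|[|[|k2]]] // in mw1 mw2 eq_k x1_le x2_le *.
- by have := two_marks_glue_unmarked metric1 perimeter1 two2 mw2 x2_le; lia.
- have := metric1 _ _ _ (marking_cons_off c mw1) isT.
  have := metric2 _ _ _ (marking_cons_off c mw2) isT.
  have := two1 _ _ (marking_cons_on c mw1).
  by have := two2 _ _ (marking_cons_on c mw2); lia.
by have := two_marks_glue_unmarked metric2 perimeter2 two1 mw1 x1_le; lia.
Qed.

Hypothesis C_ge : 2 * delta + K2 <= C.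
Hypothesis K1_gt0 : 0 < K1.

Lemma three_marks_glue_unmarked w1 w2 x r :
  marked_metric E (c :: w1) -> odd_perimeter_bound K1 (c :: w1) ->
  three_marks_bound C (c :: w2) -> marking w2 3 x r -> x <= 3 * delta ->
  odd (sumn w1 + x + r) = odd C -> x < C + sumn w1 + r.
Proof.
rewrite /odd_perimeter_bound /=.
move=> /chord_le_sumn c_le perimeter1 three2 mw x_le.
by have := three2 _ _ (marking_cons_off c mw); lia.
Qed.

Lemma three_marks_glue_one_two w1 w2 x1 r1 x2 r2 :
  marked_metric E (c :: w1) -> two_marks_bound K2 (c :: w1) ->
  three_marks_bound C (c :: w2) -> marking w1 1 x1 r1 -> marking w2 2 x2 r2 ->
  x2 <= 2 * delta -> odd (x1 + x2 + (r1 + r2)) = odd C ->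
  x1 + x2 < C + (r1 + r2).
Proof.
move=> metric1 two1 three2 mw1 mw2 x2_le.
have := metric1 _ _ _ (marking_cons_off c mw1) isT.
have := two1 _ _ (marking_cons_on c mw1).
by have := three2 _ _ (marking_cons_on c mw2); lia.
Qed.

Lemma three_marks_glue w1 w2 : labels_in delta w1 -> labels_in delta w2 ->
  marked_metric E (c :: w1) -> marked_metric E (c :: w2) ->
  odd_perimeter_bound K1 (c :: w1) -> odd_perimeter_bound K1 (c :: w2) ->
  two_marks_bound K2 (c :: w1) -> two_marks_bound K2 (c :: w2) ->
  three_marks_bound C (c :: w1) -> three_marks_bound C (c :: w2) ->
  three_marks_bound C (w1 ++ w2).
Proof.
move=> in1 in2 metric1 metric2 perimeter1 perimeter2 two1 two2 three1 three2.
move=> x r /marking_catP[k1 [x1 [r1 [k2 [x2 [r2 [mw1 mw2 eq_k -> ->]]]]]]].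
move=> odd_w.
have x1_le := marking_le in1 mw1; have x2_le := marking_le in2 mw2.
have [sum1 sum2] := (marking_sum mw1, marking_sum mw2).
case: k1 k2 => [|[|[|[|k1]]]] [|[|[|[|k2]]]] // in mw1 mw2 eq_k x1_le x2_le *.
- by have := three_marks_glue_unmarked metric1 perimeter1 three2 mw2 x2_le; lia.
- exact: three_marks_glue_one_two metric1 two1 three2 mw1 mw2 x2_le odd_w.
- rewrite (addnC x1) (addnC r1) in odd_w *.
  exact: three_marks_glue_one_two metric2 two2 three1 mw2 mw1 x1_le odd_w.
by have := three_marks_glue_unmarked metric2 perimeter2 three1 mw1 x1_le; lia.
Qed.

End Gluing.

Lemma marked_metric_zero delta E w : 2 * delta + 2 <= E -> labels_in delta w ->
  marked_metric E w -> marked_metric E (0 :: w).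
Proof.
move=> E_ge w_in metric k x r /marking_zeroE[mw|[k' -> mw odd_k]].
  exact: metric.
have := marking_cost w_in mw E_ge; have := marking_le w_in mw.
by rewrite mulSn; lia.
Qed.

Lemma two_marks_zero E K2 w : 0 < K2 -> marked_metric E w ->
  two_marks_bound K2 w -> two_marks_bound K2 (0 :: w).
Proof.
move=> K2_gt0 metric two x r /marking_zeroE[mw|[_ /esym[->] mw _]].
  exact: two.
by have := metric _ _ _ mw isT; lia.
Qed.

Lemma three_marks_zero delta C w : 2 * delta < C -> labels_in delta w ->
  three_marks_bound C w -> three_marks_bound C (0 :: w).
Proof.
move=> C_gt w_in three x r /marking_zeroE[mw|[_ /esym[->] mw _]].
  exact: three.
by have := marking_le w_in mw; lia.
Qed.

Record magic_parameters (delta K1 K2 C0 C1 E M : nat) : Prop :=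
  MagicParameters {
  magic_K1 : 0 < K1 <= M;
  magic_M : 1 < M < delta;
  magic_M_ge : delta <= 2 * M;
  magic_M_K2 : 2 * delta <= M + 2 * K2 /\ M <= K2;
  magic_K : 2 * delta <= K1 + 2 * K2 + 1;
  magic_E : [/\ 2 * delta + 2 <= E, 2 * delta + K1 <= E & 2 * M + delta <= E];
  magic_tight : 2 * delta = K1 + 2 * K2 + 1 -> 2 * delta + K1 + 1 <= E;
  magic_C : [/\ maxn C0 C1 = E + 2, ~~ odd C0 & odd C1];
  magic_C_gap : (minn C0 C1).+1 < maxn C0 C1 ->
    2 * delta + K2 <= minn C0 C1 /\ 2 * delta + M + 1 <= minn C0 C1
}.

Section CaseThree.

Variables delta K1 K2 C0 C1 E M : nat.
Hypothesis magic : magic_parameters delta K1 K2 C0 C1 E M.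
Local Notation C := (minn C0 C1).
Local Notation C' := (maxn C0 C1).

Record case_III_good (w : seq nat) : Prop := CaseIIIGood {
  good_metric : marked_metric E w;
  good_perimeter : odd_perimeter_bound K1 w;
  good_two_marks : two_marks_bound K2 w;
  good_three_marks : C.+1 < C' -> three_marks_bound C w
}.

Definition case_III_word (w : seq nat) : bool := `[< case_III_good w >].

Lemma case_III_rot w1 w2 : case_III_word (w1 ++ w2) -> case_III_word (w2 ++ w1).
Proof.
have rot k x r : marking (w2 ++ w1) k x r -> marking (w1 ++ w2) k x r.
  case/marking_catP=> k2 [x2 [r2 [k1 [x1 [r1 [mw2 mw1 -> -> ->]]]]]].
  by rewrite (addnC k2) (addnC x2) (addnC r2); apply: marking_cat.
move=> /asboolP[metric perimeter two three]; apply/asboolP; split=> [k x r|||].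
- by move/rot/metric.
- by move: perimeter; rewrite /odd_perimeter_bound !sumn_cat addnC.
- by move=> x r /rot/two.
by move=> gap x r /rot/(three gap).
Qed.

Lemma case_III_long w : labels_in delta w ->
  E + 2 * K1 + 3 * delta + 4 < size w -> case_III_good w.
Proof.
move=> w_in w_long; have [E_ge _ _] := magic_E magic.
have bounds k x r : marking w k x r ->
    [/\ 2 * size w + 2 * x <= 2 * r + k * E, size w <= k + r & x <= k * delta].
  move=> mw; split; first exact: marking_cost w_in mw _ E_ge.
    exact: marking_size w_in mw.
  exact: marking_le w_in mw.
split=> [k x r /bounds[] + _ _ _|_|x r /bounds[]|_ x r /bounds[]]; try lia.
by have [_] := bounds _ _ _ (marking0 w); lia.
Qed.

Lemma case_III_nil : case_III_good [::].
Proof. by split=> // [k x r|x r|_ x r] [s [/[!subseq0]/eqP-> // <- //]]. Qed.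

Lemma case_III_pair a : case_III_good [:: a; a].
Proof.
split; rewrite /odd_perimeter_bound /=; try lia.
- move=> k x r [s [/subseqP[m]]]; case: m => [|[] [|[] []]] //= _ -> <- <-;
    rewrite /odd_marks_bound /= ?mul1n; lia.
- by move=> x r [s [/subseqP[m]]]; case: m => [|[] [|[] []]] //= _ -> //= _ <-;
    lia.
by move=> _ x r [s [/subseqP[m]]]; case: m => [|[] [|[] []]] //= _ ->.
Qed.

Lemma case_III_word_class : word_class delta case_III_word.
Proof.
have [E_ge _ _] := magic_E magic; have K1_pos := magic_K1 magic.
have K_ge := magic_K magic; have M_bounds := magic_M_K2 magic.
split.
- exact/asboolP/case_III_nil.
- by move=> a; apply/asboolP; apply: case_III_pair.
- exact: case_III_rot.
- move=> w w_in /asboolP[metric perimeter two three]; apply/asboolP; split=> //.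
  + exact: marked_metric_zero w_in metric.
  + by apply: (two_marks_zero _ metric two); lia.
  move=> gap; have [_ C_gt] := magic_C_gap magic gap.
  by apply: (three_marks_zero _ w_in (three gap)); lia.
- move=> c w1 w2 in1 in2 /asboolP[metric1 perimeter1 two1 three1].
  move=> /asboolP[metric2 perimeter2 two2 three2]; apply/asboolP; split.
  + exact: marked_metric_glue metric1 metric2.
  + exact: odd_perimeter_glue metric1 metric2 perimeter1 perimeter2.
  + exact: (two_marks_glue K_ge in1 in2 metric1 metric2 perimeter1).
  move=> gap; have [C_ge _] := magic_C_gap magic gap.
  have [K1_gt0 _] := andP K1_pos.
  apply: (three_marks_glue K_ge C_ge K1_gt0 in1 in2 metric1 metric2) => //.
    exact: three1.
  exact: three2.
exists (E + 2 * K1 + 3 * delta + 4) => w w_in w_long.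
by apply/asboolP; apply: case_III_long.
Qed.

Lemma case_III_triangle a b c : a <= b + c -> b <= a + c -> c <= a + b ->
  triangle_allowed K1 K2 C0 C1 a b c -> case_III_word [:: a; b; c].
Proof.
move=> ta tb tc; rewrite /triangle_allowed /= => -[allowed_odd allowed_even].
have [C'E even_C0 odd_C1] := magic_C magic.
have [le_E lt_C] : a + b + c <= E /\ (odd (a + b + c) = odd C -> a + b + c < C).
  have [odd_p|even_p] := boolP (odd (a + b + c)).
    by have [_ _] := allowed_odd odd_p; lia.
  by have := allowed_even even_p; lia.
have odd_bounds : odd (a + b + c) ->
    2 * K1 < a + b + c /\ a + b + c < 2 * K2 + 2 * minn a (minn b c).
  by case/allowed_odd.
apply/asboolP; split; rewrite /odd_perimeter_bound /=; try lia.
- move=> k x r [s [/subseqP[m]]];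
    case: m => [|[] [|[] [|[] []]]] //= _ -> <- <-;
    rewrite /odd_marks_bound /= ?mul1n; lia.
- by move=> x r [s [/subseqP[m]]];
    case: m => [|[] [|[] [|[] []]]] //= _ -> //= _ <-; lia.
by move=> _ x r [s [/subseqP[m]]];
  case: m => [|[] [|[] [|[] []]]] //= _ -> //= _ <-; lia.
Qed.

Section Completion.

Variable G : lgraph delta.
Hypothesis goodG : good_graph G case_III_word.
Implicit Types u v : G.

Lemma closed_walk_case_III u k x r : marked_walk u u k x r ->
  exists2 w, case_III_good w & marking w k x r.
Proof.
move=> walk; have [w [_ /asboolP good_w mw]] :=
  marked_walk_closed case_III_word_class goodG walk.
by exists w.
Qed.

Definition magic_centre u v : nat := M.

Lemma completable_magic : completable E magic_centre.
Proof.
have [E_ge _ E_M] := magic_E magic.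
split=> // [u k x r|u v|u v]; [|exact: magic_M magic|exact: magic_M_ge magic].
by case/closed_walk_case_III=> w /good_metric metric /metric.
Qed.

Local Notation d := (completion E magic_centre).

Lemma upper_walk u v : u != v -> d u v < M ->
  marked_walk u v 0 0 (d u v) \/ E <= d u v + 2 * delta.
Proof.
move=> uv lt_M; have d_clamped := completionP completable_magic uv.
have E_ge := completable_E completable_magic.
by have := upper_plain E_ge (clamped_upper d_clamped lt_M).
Qed.

Lemma lower_walk u v : u != v -> M < d u v ->
  (exists x r, marked_walk u v 1 x r /\ d u v + r = x) \/
  d u v + E <= 3 * delta.
Proof.
move=> uv gt_M; have d_clamped := completionP completable_magic uv.
have E_ge := completable_E completable_magic.
by have := lower_plain E_ge (clamped_lower d_clamped gt_M).
Qed.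

Lemma short_completion_walk u v : u != v -> d u v < K1 ->
  marked_walk u v 0 0 (d u v).
Proof.
move=> uv lt_K1; have [_ E_K1 _] := magic_E magic; have K1_le := magic_K1 magic.
have lt_M : d u v < M by lia.
by have [//|] := upper_walk uv lt_M; lia.
Qed.

Lemma completion_odd_perimeter (x y z : G) : x != y -> y != z -> x != z ->
  odd (d x y + d y z + d x z) -> 2 * K1 < d x y + d y z + d x z.
Proof.
move=> xy yz xz odd_p; rewrite ltnNge; apply/negP=> p_le.
have [tri_xz tri_yz tri_xy] := completion_triangles completable_magic x y z.
have [xy_lt yz_lt xz_lt] : [/\ d x y < K1, d y z < K1 & d x z < K1].
  by split; lia.
have walk_xy := short_completion_walk xy xy_lt.
have walk_yz := short_completion_walk yz yz_lt.
have walk_zx := marked_walk_rev (short_completion_walk xz xz_lt).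
have [w good_w mw] :=
  closed_walk_case_III (marked_walk_cat3 walk_xy walk_yz walk_zx).
have := good_perimeter good_w; rewrite /odd_perimeter_bound (marking_sum mw).
by lia.
Qed.

Lemma completion_two_sides (x y z : G) : x != y -> y != z -> x != z ->
  odd (d x y + d y z + d x z) -> d x y + d y z < 2 * K2 + d x z.
Proof.
move=> xy yz xz odd_p; rewrite ltnNge; apply/negP=> too_long.
have [tri_xz tri_yz tri_xy] := completion_triangles completable_magic x y z.
have xy_le := completion_le completable_magic xy.
have yz_le := completion_le completable_magic yz.
have xz_gt0 := completion_gt0 completable_magic xz.
have [_ E_K1 _] := magic_E magic.
have K1_M := magic_K1 magic; have K_ge := magic_K magic.
have [M_K2 M_le] := magic_M_K2 magic; have tight := magic_tight magic.
have [xz_lt xy_gt yz_gt] : [/\ d x z < M, M < d x y & M < d y z] by split; lia.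
have [[x1 [r1 [walk_xy len_xy]]]|] := lower_walk xy xy_gt; last by lia.
have [[x2 [r2 [walk_yz len_yz]]]|] := lower_walk yz yz_gt; last by lia.
have [/marked_walk_rev walk_zx|] := upper_walk xz xz_lt; last by lia.
have [w good_w mw] :=
  closed_walk_case_III (marked_walk_cat3 walk_xy walk_yz walk_zx).
by have := good_two_marks good_w mw; lia.
Qed.

Lemma completion_three_sides (x y z : G) : x != y -> y != z -> x != z ->
  C.+1 < C' -> odd (d x y + d y z + d x z) = odd C -> d x y + d y z + d x z < C.
Proof.
move=> xy yz xz gap odd_p; rewrite ltnNge; apply/negP=> too_long.
have [C_K2 C_M] := magic_C_gap magic gap; have [C'E _ _] := magic_C magic.
have xy_le := completion_le completable_magic xy.
have yz_le := completion_le completable_magic yz.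
have xz_le := completion_le completable_magic xz.
have [xy_gt yz_gt xz_gt] : [/\ M < d x y, M < d y z & M < d x z] by split; lia.
have M_ge := magic_M_ge magic.
have [[x1 [r1 [walk_xy len_xy]]]|] := lower_walk xy xy_gt; last by lia.
have [[x2 [r2 [walk_yz len_yz]]]|] := lower_walk yz yz_gt; last by lia.
have [[x3 [r3 [walk_xz len_xz]]]|] := lower_walk xz xz_gt; last by lia.
have walk_zx := marked_walk_rev walk_xz.
have [w good_w mw] :=
  closed_walk_case_III (marked_walk_cat3 walk_xy walk_yz walk_zx).
by have := good_three_marks good_w gap mw; lia.
Qed.

Lemma completion_lt_C (x y z : G) : x != y -> y != z -> x != z ->
  odd (d x y + d y z + d x z) = odd C -> d x y + d y z + d x z < C.
Proof.
move=> xy yz xz odd_p; have [gap|no_gap] := ltnP C.+1 C'.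
  exact: completion_three_sides.
have [C'E even_C0 odd_C1] := magic_C magic.
by have := completion_perimeter completable_magic xy yz xz; lia.
Qed.

Lemma case_III_allowed (x y z : G) : x != y -> y != z -> x != z ->
  triangle_allowed K1 K2 C0 C1 (d x y) (d y z) (d x z).
Proof.
move=> xy yz xz; have [yx zy] : y != x /\ z != y by rewrite eq_sym xy eq_sym yz.
have dC u v : d u v = d v u := completionC completable_magic u v.
have two_xz := completion_two_sides xy yz xz.
have := completion_two_sides yx xz yz; rewrite (dC y x) => two_yz.
have := completion_two_sides xz zy xy; rewrite (dC z y) => two_xy.
have := completion_lt_C xy yz xz; have := completion_odd_perimeter xy yz xz.
have := completion_perimeter completable_magic xy yz xz.
rewrite /triangle_allowed /=.
move: (d x y) (d y z) (d x z) two_xz two_yz two_xy => a b c two_c two_b two_a.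
have [C'E even_C0 odd_C1] := magic_C magic; move=> le_E K1_lt lt_C.
split=> [odd_p|even_p]; last by lia.
have [K1_lt_p c_lt] := (K1_lt odd_p, two_c odd_p).
have a_lt : c + b < 2 * K2 + a by apply: two_a; lia.
have b_lt : a + c < 2 * K2 + b by apply: two_b; lia.
by split; lia.
Qed.

End Completion.

Lemma coherent_EPPA_case_III (S : metricSpace -> Prop) :
  (forall X : metricSpace, S X -> henson_constraint delta X) ->
  coherent_EPPA (fun A => class_A delta K1 K2 C0 C1 A /\ class_AS S A).
Proof.
apply: coherent_EPPA_completion case_III_word_class _ _ =>
  [a b c _ _ _|G goodG].
  exact: case_III_triangle.
exists (@magic_centre G); split; first exact: completable_magic.
exact: case_III_allowed.
Qed.

End CaseThree.

(** * The exceptional parameters of Case (II) *)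

Section Polygons.

Variable f : nat -> nat.
Implicit Types w : seq nat.

Definition polygon w : bool := all (fun a => 2 * f a <= sumn (map f w)) w.

Lemma polygon_catC w1 w2 : polygon (w1 ++ w2) = polygon (w2 ++ w1).
Proof. by rewrite /polygon !map_cat !sumn_cat addnC !all_cat andbC. Qed.

Lemma polygon_glue c w1 w2 :
  polygon (c :: w1) -> polygon (c :: w2) -> polygon (w1 ++ w2).
Proof.
rewrite /polygon all_cat map_cat sumn_cat /= => /andP[c1 all1] /andP[c2 all2].
by apply/andP; split; [apply: sub_all all1 | apply: sub_all all2] => a /=; lia.
Qed.

Lemma polygon_zero w : f 0 = 0 -> polygon w -> polygon (0 :: w).
Proof. by rewrite /polygon /= => ->. Qed.

Lemma polygon_long m w : all (fun a => 0 < f a <= m) w -> 2 * m <= size w ->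
  polygon w.
Proof.
move=> w_in w_long; have size_le : size w <= sumn (map f w).
  by elim: w w_in {w_long} => //= a w IHw /andP[/andP[fa _] /IHw]; lia.
by apply: sub_all w_in => a /andP[_]; lia.
Qed.

End Polygons.

Section CaseTwo.

Variables delta K : nat.
Hypotheses (delta_gt7 : 7 < delta) (K_delta : 3 * K + 1 = 2 * delta).
Hypothesis K_odd : odd K.

(* A triangle of odd perimeter is allowed iff its [mu]-perimeter exceeds [2K];
   one of even perimeter is allowed iff it is metric, and then its sides also
   satisfy the triangle inequality for [mu]. *)
Definition mu (a : nat) : nat := minn a (2 * K - a).

Lemma mu_gt0 a : 0 < a <= delta -> 0 < mu a <= delta.
Proof. by rewrite /mu; lia. Qed.

Lemma mu_le a : mu a <= K.
Proof. by rewrite /mu; lia. Qed.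

Definition odd_mu_bound (w : seq nat) : bool :=
  odd (sumn w) ==> (2 * K < sumn (map mu w)).

Definition case_II_word (w : seq nat) : bool :=
  [&& polygon id w, polygon mu w & odd_mu_bound w].

Lemma odd_mu_bound_glue c w1 w2 :
  polygon mu (c :: w1) -> polygon mu (c :: w2) ->
  odd_mu_bound (c :: w1) -> odd_mu_bound (c :: w2) -> odd_mu_bound (w1 ++ w2).
Proof.
rewrite /polygon /odd_mu_bound map_cat !sumn_cat /= => /andP[c1 _] /andP[c2 _].
by lia.
Qed.

Lemma case_II_long w : labels_in delta w -> 2 * delta + 2 * K < size w ->
  case_II_word w.
Proof.
move=> w_in w_long; have mu_in : all (fun a => 0 < mu a <= delta) w.
  by apply: sub_all w_in => a /mu_gt0.
apply/and3P; split.
- by apply: (@polygon_long id delta) => //; lia.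
- by apply: (@polygon_long mu delta) => //; lia.
apply/implyP=> _; suff : size w <= sumn (map mu w) by lia.
by elim: w mu_in {w_in w_long} => //= a w IHw /andP[/andP[mu_a _] /IHw]; lia.
Qed.

Lemma case_II_word_class : word_class delta case_II_word.
Proof.
split.
- by [].
- by move=> a; rewrite /case_II_word /polygon /odd_mu_bound /=; lia.
- move=> w1 w2; rewrite /case_II_word (polygon_catC id) (polygon_catC mu).
  rewrite /odd_mu_bound !map_cat !sumn_cat (addnC (sumn w1)).
  by rewrite (addnC (sumn (map mu w1))).
- move=> w _ /and3P[poly_id poly_mu mu_w]; have mu0 : mu 0 = 0 by exact: min0n.
  by rewrite /case_II_word /odd_mu_bound !polygon_zero //= mu0.
- move=> c w1 w2 _ _ /and3P[id1 mu1 odd1] /and3P[id2 mu2 odd2].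
  apply/and3P; split.
  + exact: polygon_glue id1 id2.
  + exact: polygon_glue mu1 mu2.
  exact: odd_mu_bound_glue mu1 mu2 odd1 odd2.
by exists (2 * delta + 2 * K) => w; apply: case_II_long.
Qed.

Lemma mu_triangle_even a b c : a <= delta -> b <= delta -> c <= delta ->
  a <= b + c -> b <= a + c -> c <= a + b -> ~~ odd (a + b + c) ->
  mu a <= mu b + mu c.
Proof. by rewrite /mu; lia. Qed.

Lemma case_II_triangle a b c :
  1 <= a <= delta -> 1 <= b <= delta -> 1 <= c <= delta ->
  a <= b + c -> b <= a + c -> c <= a + b ->
  triangle_allowed K K (3 * delta + 2) (4 * K + 1) a b c ->
  case_II_word [:: a; b; c].
Proof.
move=> a_in b_in c_in ta tb tc.
rewrite /triangle_allowed /= => -[allowed_odd _].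
have odd_mu : odd (a + b + c) -> 2 * K < mu a + mu b + mu c.
  by move=> odd_p; have [K_lt m_lt p_lt] := allowed_odd odd_p; rewrite /mu; lia.
have [mu_a mu_b mu_c] : [/\ mu a <= mu b + mu c, mu b <= mu a + mu c
    & mu c <= mu a + mu b].
  have [/odd_mu mu_gt|even_p] := boolP (odd (a + b + c)).
    have [a_le b_le c_le] := And3 (mu_le a) (mu_le b) (mu_le c).
    by split; lia.
  by split; apply: mu_triangle_even; lia.
by rewrite /case_II_word /polygon /odd_mu_bound /= !addn0 !addnA; lia.
Qed.

Section MarkedWords.

Variables (w : seq nat) (k x r : nat).
Hypotheses (w_in : labels_in delta w) (good_w : case_II_word w).
Hypothesis mw : marking w k x r.

Lemma case_II_odd_marks : odd_marks_bound (3 * delta) k x r.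
Proof.
have x_le := marking_le w_in mw; have [s [sub sz_s sum_s sum_w]] := mw.
case: k sz_s x_le => [|[|[|k']]] //= sz_s x_le; last first.
  move=> _; have := leq_mul (isT : 3 <= k'.+3) (leqnn delta).
  by rewrite (mulnCA _ 3); lia.
case: s sub sz_s sum_s => [|a [|]] //; rewrite sub1seq /= addn0 => aw _ eq_x _.
have /and3P[/allP/(_ a aw) + _ _] := good_w.
by rewrite map_id sum_w eq_x; lia.
Qed.

Lemma marking_mu : sumn (map mu w) + x <= r + 2 * K * k.
Proof.
have [s [sub <- <- sum_w]] := mw.
have mu_le_id : all (fun a => mu a <= a) w by apply/allP=> a _; apply: geq_minl.
have := subseq_sumn_map sub mu_le_id; rewrite sum_w.
suff : sumn (map mu s) + sumn s <= 2 * K * size s by lia.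
have /allP := w_in; elim: s sub {mu_le_id sum_w} => [|a s IHs] sub //= all_w.
have aw : a \in w by apply: (mem_subseq sub); rewrite mem_head.
have := IHs (subseq_trans (subseq_cons s a) sub) all_w; rewrite mulnS.
by have := all_w a aw; rewrite /mu; lia.
Qed.

Lemma case_II_odd_mu : odd (x + r) -> 2 * K + x < r + 2 * K * k.
Proof.
have /and3P[_ _ /implyP] := good_w; rewrite (marking_sum mw) => odd_mu /odd_mu.
by have := marking_mu; lia.
Qed.

End MarkedWords.

Section Completion.

Variable G : lgraph delta.
Hypothesis goodG : good_graph G case_II_word.
Implicit Types u v : G.

(* All walks of [mu]-length at most [K] between two points have the same parity,
   which forces the parity of the distance. *)
Definition short_walk u v (b : bool) : Prop := exists k x r,
  [/\ marked_walk u v k x r, odd (x + r) = b & r + 2 * K * k <= K + x].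

Definition parity_centre u v : nat :=
  if `[< short_walk u v false >] then K.-1 else K.

Lemma parity_centre_bounds u v : K.-1 <= parity_centre u v <= K.
Proof. by rewrite /parity_centre; case: ifP => _; lia. Qed.

Lemma parity_centreC u v : parity_centre u v = parity_centre v u.
Proof. by rewrite /parity_centre /short_walk marked_walkC. Qed.

Lemma parity_centre_aut (s : {perm G}) u v : label_automorphism s ->
  parity_centre (s u) (s v) = parity_centre u v.
Proof. by move=> sP; rewrite /parity_centre /short_walk marked_walk_aut. Qed.

Lemma closed_walk_case_II u k x r : marked_walk u u k x r ->
  exists w, [/\ labels_in delta w, case_II_word w & marking w k x r].
Proof. exact: marked_walk_closed case_II_word_class goodG. Qed.

Lemma completable_parity : completable (3 * delta) parity_centre.
Proof.
split=> [|u k x r|u v|s sP u v|u v x y|u v|u v|u v]; first by lia.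
- by case/closed_walk_case_II=> w [w_in good_w mw];
    apply: case_II_odd_marks w_in good_w mw.
- exact: parity_centreC.
- exact: parity_centre_aut.
- by have := parity_centre_bounds u v; have := parity_centre_bounds x y; lia.
all: by have := parity_centre_bounds u v; lia.
Qed.

Local Notation d := (completion (3 * delta) parity_centre).

Lemma completion_mu_gt0 u v : u != v -> 0 < mu (d u v).
Proof.
move=> uv; have : 0 < d u v <= delta.
  rewrite (completion_gt0 completable_parity uv).
  by rewrite (completion_le completable_parity uv).
by case/mu_gt0/andP.
Qed.

Definition no_short_walk u v : Prop :=
  forall k x r, marked_walk u v k x r -> K + x < r + 2 * K * k.

Lemma completion_walk u v : u != v -> no_short_walk u v /\ d u v = K \/
  exists k x r, [/\ marked_walk u v k x r, odd (x + r) = odd (d u v)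
                  & r + 2 * K * k <= mu (d u v) + x].
Proof.
move=> uv; have d_clamped := completionP completable_parity uv.
have centre_le := parity_centre_bounds u v.
have E_ge := completable_E completable_parity.
have [lt_c|gt_c|eq_c] := ltngtP (d u v) (parity_centre u v).
- have [walk|] := upper_plain E_ge (clamped_upper d_clamped lt_c); last by lia.
  by right; exists 0, 0, (d u v); split=> //; rewrite /mu; lia.
- have [[x [r [walk eq_x]]]|] :=
    lower_plain E_ge (clamped_lower d_clamped gt_c); last by lia.
  by right; exists 1, x, r; split=> //; [lia | rewrite /mu; lia].
rewrite eq_c /parity_centre.
case: asboolP => [[k [x [r [walk parity short]]]]|no_even].
  by right; exists k, x, r; split=> //; [lia | rewrite /mu; lia].
have [[k [x [r [walk parity short]]]]|no_odd] := EM (short_walk u v true).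
  by right; exists k, x, r; split=> //; [lia | rewrite /mu; lia].
left; split=> // k x r walk; rewrite ltnNge; apply/negP=> short.
by case parity: (odd (x + r)); [apply: no_odd | apply: no_even]; exists k, x, r.
Qed.

Lemma completion_no_short_walk (x y z : G) : x != y -> y != z ->
  no_short_walk x z -> 2 * K < mu (d x y) + mu (d y z) + K.
Proof.
move=> xy yz far_xz; have muK : mu K = K by rewrite /mu; lia.
have xy_gt0 := completion_mu_gt0 xy; have yz_gt0 := completion_mu_gt0 yz.
have [[_ eq_xy]|[k1 [x1 [r1 [walk_xy _ short_xy]]]]] := completion_walk xy.
  by rewrite eq_xy muK; lia.
have [[_ eq_yz]|[k2 [x2 [r2 [walk_yz _ short_yz]]]]] := completion_walk yz.
  by rewrite eq_yz muK; lia.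
by have := far_xz _ _ _ (marked_walk_cat walk_xy walk_yz); rewrite mulnDr; lia.
Qed.

Lemma completion_odd_mu (x y z : G) : x != y -> y != z -> x != z ->
  odd (d x y + d y z + d x z) -> 2 * K < mu (d x y) + mu (d y z) + mu (d x z).
Proof.
move=> xy yz xz odd_p.
have [yx zy] : y != x /\ z != y by rewrite eq_sym xy eq_sym yz.
have dC u v : d u v = d v u := completionC completable_parity u v.
have muK : mu K = K by rewrite /mu; lia.
have [[far_xz ->]|[k3 [x3 [r3 [walk_xz odd3 short3]]]]] := completion_walk xz.
  by rewrite muK; apply: completion_no_short_walk.
have [[far_xy ->]|[k1 [x1 [r1 [walk_xy odd1 short1]]]]] := completion_walk xy.
  by have := completion_no_short_walk xz zy far_xy; rewrite muK (dC z y); lia.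
have [[far_yz ->]|[k2 [x2 [r2 [walk_yz odd2 short2]]]]] := completion_walk yz.
  by have := completion_no_short_walk yx xz far_yz; rewrite muK (dC y x); lia.
have walk_zx := marked_walk_rev walk_xz.
have [w [w_in good_w mw]] :=
  closed_walk_case_II (marked_walk_cat3 walk_xy walk_yz walk_zx).
have odd_w : odd (x1 + x2 + x3 + (r1 + r2 + r3)).
  by rewrite addnACA (addnACA x1) oddD (oddD (x1 + r1)) odd1 odd2 odd3 -!oddD.
have := case_II_odd_mu w_in good_w mw odd_w; rewrite !mulnDr.
by clear -short1 short2 short3; lia.
Qed.

Lemma case_II_allowed (x y z : G) : x != y -> y != z -> x != z ->
  triangle_allowed K K (3 * delta + 2) (4 * K + 1) (d x y) (d y z) (d x z).
Proof.
move=> xy yz xz; have odd_mu := completion_odd_mu xy yz xz.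
have xy_le := completion_le completable_parity xy.
have yz_le := completion_le completable_parity yz.
have xz_le := completion_le completable_parity xz.
rewrite /triangle_allowed /=; split=> [/odd_mu|even_p]; last by lia.
by rewrite /mu; split; lia.
Qed.

End Completion.

Lemma coherent_EPPA_case_II (S : metricSpace -> Prop) :
  (forall X : metricSpace, S X -> henson_constraint delta X) ->
  coherent_EPPA
    (fun A => class_A delta K K (3 * delta + 2) (4 * K + 1) A /\ class_AS S A).
Proof.
apply: coherent_EPPA_completion case_II_word_class case_II_triangle _ =>
  G goodG.
exists (@parity_centre G); split; first exact: completable_parity.
exact: case_II_allowed.
Qed.

End CaseTwo.

(** * Parameters with a Henson constraint *)

Lemma henson_triangle delta K1 K2 C0 C1 (X : metricSpace) :
  henson_constraint delta X -> (exists i : 'I_4 -> X, injective i) ->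
  no_forbidden_triangle K1 K2 C0 C1 X ->
  exists a b c, [/\ a = 1 \/ a = delta, b = 1 \/ b = delta, c = 1 \/ c = delta,
    [/\ a <= b + c, b <= a + c & c <= a + b]
    & triangle_allowed K1 K2 C0 C1 a b c].
Proof.
move=> hensonX [i i_inj] triX; have [_ distC distT] := dist_metric X.
have neq (j k : 'I_4) : j != k -> i j <> i k by move=> jk /i_inj; apply/eqP.
pose x := i (inord 0); pose y := i (inord 1); pose z := i (inord 2).
have [xy yz xz] : [/\ x <> y, y <> z & x <> z].
  by split; apply: neq; rewrite -val_eqE /= !inordK.
exists (dist x y), (dist y z), (dist x z); split; try exact: hensonX.
  split; last exact: distT.
    by rewrite addnC (distC y z); apply: distT.
  by rewrite (distC x y); apply: distT.
exact: triX.
Qed.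

(* A side of length 1 makes the perimeter odd, and then the perimeter is too
   short or too long. *)
Lemma henson_triangle_equilateral delta K1 K2 C0 C1 a b c :
  2 < delta -> 1 < K1 -> K2 < delta ->
  a = 1 \/ a = delta -> b = 1 \/ b = delta -> c = 1 \/ c = delta ->
  a <= b + c -> b <= a + c -> c <= a + b ->
  triangle_allowed K1 K2 C0 C1 a b c -> [/\ a = delta, b = delta & c = delta].
Proof.
move=> delta_gt2 K1_gt1 K2_lt a_side b_side c_side ta tb tc.
rewrite /triangle_allowed /= => -[allowed_odd _].
suff no_short : ~ (a = 1 \/ b = 1 \/ c = 1) by split; lia.
move=> short; have odd_p : odd (a + b + c) by lia.
by have [K1_lt m_lt _] := allowed_odd odd_p; lia.
Qed.

Lemma case_II_henson delta K1 K2 C0 C1 (X : metricSpace) :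
  primitive_admissible_num delta K1 K2 C0 C1 -> case_II delta K1 K2 C0 C1 ->
  henson_constraint delta X -> (exists i : 'I_4 -> X, injective i) ->
  no_forbidden_triangle K1 K2 C0 C1 X ->
  [/\ K2 = K1, C0 = 3 * delta + 2 & C1 = 4 * K1 + 1] /\
  [/\ 7 < delta, 3 * K1 + 1 = 2 * delta & odd K1].
Proof.
case=> delta_gt2 [[K1_gt0 K1_K2 _] [[C0_in C1_in even_C0 odd_C1]]].
case=> -[C0_ge C1_ge] _.
case=> C_le C_eq _ K_le C'_cases hensonX i_inj triX.
have [a [b [c [a_side b_side c_side [ta tb tc] tri]]]] :=
  henson_triangle hensonX i_inj triX.
have [K2_lt K1_gt1] : K2 < delta /\ 1 < K1 by lia.
have equilateral := henson_triangle_equilateral delta_gt2 K1_gt1 K2_lt.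
have [eq_a eq_b eq_c] :=
  equilateral _ _ _ _ _ a_side b_side c_side ta tb tc tri.
move: tri; rewrite eq_a eq_b eq_c /triangle_allowed /= => -[tri_odd tri_even].
have [odd_delta|even_delta] := boolP (odd (delta + delta + delta)).
  have [_ _ C1_gt] := tri_odd odd_delta.
  by case: C'_cases => [|[]]; lia.
have C0_gt := tri_even even_delta.
by case: C'_cases => [|[]]; [lia | split; split; lia].
Qed.

Lemma magic_parameters_exist delta K1 K2 C0 C1 :
  primitive_admissible_num delta K1 K2 C0 C1 -> case_III delta K1 K2 C0 C1 ->
  K1 <> delta -> minn C0 C1 <> 2 * delta + 2 ->
  exists E M, magic_parameters delta K1 K2 C0 C1 E M.
Proof.
case=> delta_gt2 [[K1_gt0 K1_K2 K2_le] [[C0_in C1_in even_C0 odd_C1]]].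
case=> -[C0_ge C1_ge] _.
case=> C_gt K_ge K2_ge tight gap K1_neq C_neq.
exists (maxn C0 C1 - 2), (maxn K1 (maxn (uphalf delta) (2 * delta - 2 * K2))).
have C_lt_C' : minn C0 C1 < maxn C0 C1 by lia.
have C'_le : maxn C0 C1 <= 3 * delta + 2 by lia.
have {C_neq} C_ge : 2 * delta + 3 <= minn C0 C1 by lia.
have K1_lt : K1 < delta by lia.
by split=> //; try lia; split; lia.
Qed.

Theorem theorem5p5 (delta K1 K2 C0 C1 : nat) (S : metricSpace -> Prop)
    (Hadm : primitive_admissible delta K1 K2 C0 C1 S)
    (Hnonempty : exists X : metricSpace, S X)
    (Hhenson : forall X : metricSpace, S X -> henson_constraint delta X) :
  coherent_EPPA
    (fun A => class_A delta K1 K2 C0 C1 A /\ class_AS S A).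
Proof.
have [num S_henson S_empty] := Hadm; have [X SX] := Hnonempty.
have [hensonX i_inj triX] := S_henson X SX.
have [_ [_ [_ [_ [cII|cIII]]]]] := num.
  have [[-> -> ->] [delta_gt7 K_delta K_odd]] :=
    case_II_henson num cII hensonX i_inj triX.
  exact: coherent_EPPA_case_II.
have K1_neq : K1 <> delta.
  by move=> eqK1; apply: S_empty cIII (or_introl eqK1) X SX.
have C_neq : minn C0 C1 <> 2 * delta + 2.
  by move=> eqC; apply: S_empty cIII (or_intror eqC) X SX.
have [E [M magic]] := magic_parameters_exist num cIII K1_neq C_neq.
exact: coherent_EPPA_case_III magic S Hhenson.
Qed.
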